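(* Let $\omega\in\mathbb R\setminus\{0\}$ be fixed. There exist $\delta_0\in(0,1)$ and $\varepsilon>0$ such that for every fixed $\delta\in(0,\delta_0)$ and every fixed $D\in\mathbb R$ with $|D|<\varepsilon$ the phase-lock areas in $\mathbb R^2_{B,A}$ of the family $$\frac{d\theta}{d\tau}=\frac{\cos\theta+B+A\sin\tau}{\omega(1-\delta\cos\tau)}+D$$ of dynamical systems on $\mathbb T^2=\mathbb R^2_{\theta,\tau}/2\pi\mathbb Z^2$ with parameters $(B,A)\in\mathbb R^2$ have no constrictions. Thus, for each phase-lock area, the intersections of its interior with the upper half-plane $\{A>0\}$ and with the lower half-plane $\{A<0\}$ are connected.
   Context: The family is viewed as a perturbation (small $\delta\neq0$, small $D$) of the RSJ model $\frac{d\theta}{d\tau}=\frac1\omega(\cos\theta+B+A\sin\tau)$, which corresponds to $\delta=D=0$. The rotation number of such an equation is $\rho=\lim_{T\to+\infty}\theta(T)/T$, where $\theta(\tau)$ is any real-valued (lifted) solution (the limit is independent of the solution). With $\omega,\delta,D$ fixed, $\rho=\rho(B,A)$ is a function on $\mathbb R^2_{B,A}$, and its phase-lock areas are the level sets of $\rho$ with non-empty interior. A constriction of a phase-lock area $L$ is a point $(B_0,A_0)\in L$ with $A_0\neq0$ such that the intersection of $L$ with the horizontal line $\{A=A_0\}$ is the single point $(B_0,A_0)$. *)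

(* Defs.v *)
From mathcomp Require Import all_boot all_order all_algebra.
From mathcomp Require Import all_classical all_reals all_analysis.
Set Implicit Arguments.
Unset Strict Implicit.
Unset Printing Implicit Defensive.
Import Order.TTheory GRing.Theory Num.Theory.
Import numFieldNormedType.Exports.
Local Open Scope classical_set_scope.
Local Open Scope ring_scope.

(* The right-hand side [f theta tau] is 2pi-periodic in both variables; the
   solutions on the torus are represented by their real-valued lifts. *)
Definition is_solution (R : realType) (f : R -> R -> R) (theta : R -> R) : Prop :=
  forall tau : R, is_derive tau 1 theta (f (theta tau) tau).

(* [lim theta(T)/T] does not depend on the (lifted) solution [theta], so any
   solution may be used to define it; [get] selects this unique limit. *)
Definition rotation_number (R : realType) (f : R -> R -> R) : R :=
  get [set rho | exists2 theta : R -> R,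
    is_solution f theta & theta T / T @[T --> +oo] --> rho].

(* Points [p] of the parameter plane are pairs (B, A). *)
Definition perturbed_RSJ (R : realType) (omega delta D : R) (p : R * R)
    (theta tau : R) : R :=
  (cos theta + p.1 + p.2 * sin tau) / (omega * (1 - delta * cos tau)) + D.

Definition phase_lock_area (R : realType) (rho : R * R -> R)
    (L : set (R * R)) : Prop :=
  (exists r : R, L = rho @^-1` [set r]) /\ L° !=set0.

Definition constriction (R : realType) (L : set (R * R)) (p : R * R) : Prop :=
  [/\ L p, p.2 != 0 & L `&` [set q | q.2 = p.2] = [set p]].

(* Main.v *)
Require Import Defs.
From mathcomp Require Import all_boot all_order all_algebra.
From mathcomp Require Import all_classical all_reals all_analysis.
From mathcomp Require Import complex ring lra.
Set Implicit Arguments.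
Unset Strict Implicit.
Unset Printing Implicit Defensive.
Import Order.TTheory GRing.Theory Num.Theory.
Import numFieldNormedType.Exports.
Local Open Scope classical_set_scope.
Local Open Scope ring_scope.

(** Why the theorem holds.

    Put a = 1 / (omega (1 - delta cos t)) and b = (B + A sin t) a + D, so that
    the equation reads theta' = a cos theta + b.  Replacing theta by - theta
    if necessary, let omega > 0; then the period map P of the equation
    ([poincare], the solution at time 2 pi as a function of its value at time
    0) increases strictly with B.

    Values of the rotation number on phase-lock areas.  The equation is the
    projectivization of a real linear system of trace zero
    ([polar_linear_solution]).  If P x - x never lies in 2 pi Z, the monodromy
    of that system is elliptic, its solutions are bounded
    ([elliptic_bounded]), and the solutions of the equations with parameters B
    and B' > B drift apart at a linear rate ([gap_grows]): the rotation number
    is strictly larger at B' than at B.  If P x = x + 2 pi k for some x and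
    some integer k, the rotation number is k ([rotation_number_int]).  So a
    level set with interior points has an integer value k, and its interior
    consists of the parameters for which P x - x - 2 pi k takes both signs
    ([level_interior]).

    Constrictions.  If P x - x - 2 pi k took a positive (or a negative) value
    at a point (B, A) of the level set of k, then it would still take both
    signs after a small decrease (increase) of B.  Hence at a constriction
    P is the translation by 2 pi k.  The heart of the matter is that this is
    impossible for A <> 0 ([trivial_period_map_amplitude0]).  Granted this,
    every horizontal line A = const <> 0 meets the interior of the level set
    in a nonempty interval, and an open set with such fibres over an
    interval is connected ([fiberwise_connected]).

    Why P is not a translation.  Let u be the true anomaly that corresponds to
    the eccentric anomaly t on an ellipse of eccentricity delta, and let
    E = sqrt (1 - delta^2), k = 1 / (omega E).  In a rotating frame a
    component y of a solution of the linear system satisfies, with the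
    derivative taken in u,
      (1 + delta cos u) (y'' - i k B y' - k^2/4 y)
        - i (k A E sin u + D E) y' = 0,
    an equation whose coefficients are trigonometric polynomials of degree
    one.  If P is a translation, all solutions are multiplied by the same
    number of modulus one over a period, so they have Fourier expansions
    with frequencies nu in mu + Z for one real mu, and the coefficients obey
      p(nu-1) c(nu-1) + q(nu) c(nu) + conj p(nu+1) c(nu+1) = 0,
      p(nu) = delta/2 (- nu^2 + k B nu - k^2/4) - i k A E nu / 2.
    A real zero of p would have A nu = 0, that is nu = 0, but
    p(0) = - delta k^2 / 8.  For two solutions with coefficients c and d the
    recurrence makes |p(nu) p(nu+1) (c(nu) d(nu+1) - c(nu+1) d(nu))|
    independent of nu; since the coefficients of smooth functions decay fast,
    it is zero ([casoratian_eq0]).  So a nontrivial combination of the two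
    solutions has two consecutive zero coefficients, hence only zero
    coefficients, hence vanishes, and the two solutions cannot be
    independent.  For delta = 0 the argument breaks down at nu = 0, in
    agreement with the constrictions of the RSJ model. *)

(** * Differentiable functions on the line *)

(** A global form of [is_derive], so that derivatives of composite expressions
    can be assembled by unification and compared by [ring]. *)
Definition hderiv (R : realType) (f f' : R -> R) : Prop :=
  forall t : R, is_derive t (1 : R) f (f' t).

Section Calculus.
Context {R : realType}.
Implicit Types (f g : R -> R) (a b c t : R).

Lemma hderiv_eq f f' g' : hderiv f f' -> (forall t, f' t = g' t) -> hderiv f g'.
Proof. by move=> df e t; rewrite -e; exact: df. Qed.

Lemma hderiv_congr f f' g g' : hderiv f f' -> (forall t, f t = g t) ->
  (forall t, f' t = g' t) -> hderiv g g'.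
Proof. by move=> df /funext <- e; exact: hderiv_eq e. Qed.

Lemma hderivC c : hderiv (fun=> c) (fun=> 0).
Proof. by move=> t; exact: is_derive_cst. Qed.

Lemma hderiv_id : hderiv (fun t => t) (fun=> 1).
Proof. by move=> t; exact: is_derive_id. Qed.

Lemma hderivD f f' g g' : hderiv f f' -> hderiv g g' ->
  hderiv (fun t => f t + g t) (fun t => f' t + g' t).
Proof. by move=> df dg t; have := is_deriveD (df t) (dg t). Qed.

Lemma hderivN f f' : hderiv f f' -> hderiv (fun t => - f t) (fun t => - f' t).
Proof. by move=> df t; have := is_deriveN (df t). Qed.

Lemma hderivB f f' g g' : hderiv f f' -> hderiv g g' ->
  hderiv (fun t => f t - g t) (fun t => f' t - g' t).
Proof. by move=> df dg; apply: hderivD => //; exact: hderivN. Qed.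

Lemma hderivM f f' g g' : hderiv f f' -> hderiv g g' ->
  hderiv (fun t => f t * g t) (fun t => f t * g' t + g t * f' t).
Proof. by move=> df dg t; have := is_deriveM (df t) (dg t). Qed.

Lemma hderivZ c f f' : hderiv f f' ->
  hderiv (fun t => c * f t) (fun t => c * f' t).
Proof.
by move=> df; apply: hderiv_eq (hderivM (hderivC c) df) _ => t /=; ring.
Qed.

Lemma hderiv_comp f f' g g' : hderiv f f' -> hderiv g g' ->
  hderiv (fun t => f (g t)) (fun t => f' (g t) * g' t).
Proof. by move=> df dg t; have := is_derive1_comp (df (g t)) (dg t). Qed.

Lemma hderiv_sin f f' : hderiv f f' ->
  hderiv (fun t => sin (f t)) (fun t => cos (f t) * f' t).
Proof. by apply: hderiv_comp => t; exact: is_derive_sin. Qed.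

Lemma hderiv_cos f f' : hderiv f f' ->
  hderiv (fun t => cos (f t)) (fun t => - sin (f t) * f' t).
Proof. by apply: (@hderiv_comp _ (fun t => - sin t)) => t; exact: is_derive_cos. Qed.

Lemma hderiv_expR f f' : hderiv f f' ->
  hderiv (fun t => expR (f t)) (fun t => expR (f t) * f' t).
Proof. by apply: hderiv_comp => t; exact: is_derive_expR. Qed.

Lemma hderiv_shift c f f' : hderiv f f' ->
  hderiv (fun t => f (t + c)) (fun t => f' (t + c)).
Proof.
move=> df.
apply: hderiv_eq (hderiv_comp df (hderivD hderiv_id (hderivC c))) _ => t /=.
by rewrite addr0 mulr1.
Qed.

Lemma hderivX f f' n : hderiv f f' ->
  hderiv (fun t => f t ^+ n) (fun t => n%:R * f t ^+ n.-1 * f' t).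
Proof. by move=> df t; have := is_deriveX n (df t); rewrite exprfctE. Qed.

Lemma is_deriveV_neq0 f t d : f t != 0 -> is_derive t (1 : R) f d ->
  is_derive t (1 : R) (fun s => (f s)^-1) (- d / f t ^+ 2).
Proof.
move=> f0 [df e]; split; first exact: derivableV.
by rewrite deriveV // e [LHS]mulrC mulrN mulNr.
Qed.

Lemma hderivV f f' : (forall t, f t != 0) -> hderiv f f' ->
  hderiv (fun t => (f t)^-1) (fun t => - f' t / f t ^+ 2).
Proof. by move=> f0 df t; exact: is_deriveV_neq0. Qed.

Lemma is_derive_div f g t df dg : g t != 0 ->
  is_derive t (1 : R) f df -> is_derive t (1 : R) g dg ->
  is_derive t (1 : R) (fun s => f s / g s) ((g t * df - f t * dg) / g t ^+ 2).
Proof.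
move=> g0 hf hg; have := is_deriveM hf (is_deriveV_neq0 g0 hg).
rewrite (_ : (_ + _ : R) = (g t * df - f t * dg) / g t ^+ 2) //.
by rewrite /GRing.scale /=; field.
Qed.

Lemma hderiv_at_continuous f t d : is_derive t (1 : R) f d -> {for t, continuous f}.
Proof.
by case=> /derivable1_diffP/differentiable_continuous.
Qed.

Lemma hderiv_continuous f f' : hderiv f f' -> continuous f.
Proof. by move=> df t; apply: hderiv_at_continuous (df t). Qed.

Lemma is_derive_ge0_le f f' a b : a <= b -> {within `[a, b], continuous f} ->
  (forall t, a < t < b -> is_derive t (1 : R) f (f' t)) ->
  (forall t, a < t < b -> 0 <= f' t) -> f a <= f b.
Proof.
rewrite le_eqVlt => /predU1P[-> //|ab] cf df f0.
have df' x : x \in `]a, b[ -> is_derive x (1 : R) f (f' x).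
  by rewrite in_itv; exact: df.
have [c cab e] := MVT ab df' cf.
rewrite -subr_ge0 e mulr_ge0 //; last by rewrite subr_ge0 ltW.
by apply: f0; rewrite in_itv in cab.
Qed.

Lemma hderiv_ge0_le f f' a b : hderiv f f' -> a <= b ->
  (forall t, a <= t <= b -> 0 <= f' t) -> f a <= f b.
Proof.
move=> df ab f0; apply: (@is_derive_ge0_le f f') => //.
- exact: (continuous_subspaceT (hderiv_continuous df)).
- by move=> t /andP[/ltW ? /ltW ?]; apply: f0; apply/andP.
Qed.

Lemma hderiv_gt0_lt f f' a b : hderiv f f' -> a < b ->
  (forall t, a <= t <= b -> 0 < f' t) -> f a < f b.
Proof.
move=> df ab f0.
have [c cab e] := MVT ab (fun x _ => df x) (continuous_subspaceT (hderiv_continuous df)).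
rewrite -subr_gt0 e mulr_gt0 ?subr_gt0 //; apply: f0.
by rewrite !(itvP cab).
Qed.

Lemma hderiv_le f f' g g' a b : hderiv f f' -> hderiv g g' -> a <= b ->
  (forall t, a <= t <= b -> f' t <= g' t) -> f b - f a <= g b - g a.
Proof.
move=> df dg ab fg.
have := @hderiv_ge0_le _ _ a b (hderivB dg df) ab.
rewrite -subr_ge0 => h; suff: g a - f a <= g b - f b by lra.
by rewrite -subr_ge0; apply: h => t tab; rewrite subr_ge0; exact: fg.
Qed.

Lemma hderiv0_cst f a b : hderiv f (fun=> 0) -> f a = f b.
Proof.
move=> df; wlog ab : a b / a <= b.
  by move=> h; have [/h//|/ltW/h//] := leP a b.
by apply/eqP; rewrite eq_le; apply/andP; split;
  have := hderiv_le df df ab (fun _ _ => lexx _);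
  have := hderiv_le df (hderivC 0) ab (fun _ _ => lexx _);
  have := hderiv_le (hderivC 0) df ab (fun _ _ => lexx _); lra.
Qed.

Lemma hderiv_unique f g f' a t : hderiv f f' -> hderiv g f' -> f a = g a -> f t = g t.
Proof.
move=> df dg e; have := @hderiv0_cst (fun t => f t - g t) a t.
rewrite e subrr => /(_ _)/esym/eqP; rewrite subr_eq0 => h; apply/eqP/h.
by apply: hderiv_eq (hderivB df dg) _ => x; rewrite subrr.
Qed.

(** Integration from - n yields a primitive on a bounded interval;
    [antiderivative] glues these primitives. *)
Lemma local_antiderivative f (n : R) : continuous f -> 0 < n ->
  exists F : R -> R, F 0 = 0 /\ forall t, `|t| < n -> is_derive t (1 : R) F (f t).
Proof.
move=> cf n0.
pose G x := (\int[@lebesgue_measure R]_(t in `[(- n), x]) f t)%R.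
have dG t : `|t| < n -> is_derive t (1 : R) G (f t).
  rewrite ltr_norml => /andP[nt tn].
  have [|dG eG] := @continuous_FTC1_closed R f (- n) t n tn _ nt (cf t).
    apply: continuous_compact_integrable; first exact: segment_compact.
    exact: continuous_subspaceT.
  by split; [exact: dG|rewrite -derive1E].
exists (fun x => G x - G 0); split; first by rewrite subrr.
move=> t /dG h.
have := is_deriveB h (is_derive_cst (G 0) t (1 : R)).
by rewrite subr0.
Qed.

Lemma antiderivative f c : continuous f -> exists F : R -> R, F 0 = c /\ hderiv F f.
Proof.
move=> cf.
have n0 (n : nat) : 0 < n.+1%:R :> R by rewrite ltr0n.
have /choice[F hF] : forall n : nat, exists F : R -> R, F 0 = 0 /\
    forall t, `|t| < n.+1%:R -> is_derive t (1 : R) F (f t).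
  by move=> n; exact: local_antiderivative.
have FF n m t : `|t| < n.+1%:R -> `|t| < m.+1%:R -> F n t = F m t.
  move=> tn tm; have [F0 dF] := hF n; have [G0 dG] := hF m.
  have dH s : `|s| <= `|t| -> is_derive s (1 : R) (F n - F m) 0.
    move=> st; rewrite -(subrr (f s)).
    by apply: is_deriveB; [apply: dF|apply: dG]; apply: le_lt_trans st _.
  have [t0|t0] := leP 0 t.
    have h1 x : x \in `]0, t[ -> is_derive x (1 : R) (F n - F m) 0.
      move=> /[!in_itv]/= /andP[x0 xt]; apply: dH.
      by rewrite (ger0_norm t0) (gtr0_norm x0) ltW.
    have h2 : {within `[0, t], continuous (F n - F m)}.
      apply: continuous_in_subspaceT => x /[!inE]/= /[!in_itv]/= /andP[x0 xt].
      by apply: hderiv_at_continuous (dH x _); rewrite !ger0_norm.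
    have [x _] := MVT_segment t0 h1 h2.
    by rewrite mul0r !fctE F0 G0; lra.
  have h1 x : x \in `]t, 0[ -> is_derive x (1 : R) (F n - F m) 0.
    move=> /[!in_itv]/= /andP[x0 xt]; apply: dH.
    by rewrite (ltr0_norm t0) (ltr0_norm xt) lerN2 ltW.
  have h2 : {within `[t, 0], continuous (F n - F m)}.
    apply: continuous_in_subspaceT => x /[!inE]/= /[!in_itv]/= /andP[x0 xt].
    by apply: hderiv_at_continuous (dH x _); rewrite !ler0_norm ?lerN2 ?(ltW t0).
  have [x _] := MVT_segment (ltW t0) h1 h2.
  by rewrite mul0r !fctE F0 G0; lra.
have lt_tr (t : R) : `|t| < (Num.truncn `|t|).+1%:R.
  by have := truncnS_gt `|t|.
exists (fun t => c + F (Num.truncn `|t|) t); split.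
  by rewrite normr0 (hF _).1 addr0.
move=> t; set N := (Num.truncn `|t|).+1.
have : is_derive t (1 : R) (cst c + F N) (f t).
  rewrite -[f t]add0r; apply: is_deriveD.
  by apply: (hF N).2; apply: lt_trans (lt_tr t) _; rewrite ltr_nat.
apply: near_eq_is_derive => /=.
near=> s; rewrite /= !fctE; congr (c + _); apply: FF; last exact: lt_tr.
have ts : `|t - s| < 1 by near: s; apply: cvgr_dist_lt.
rewrite -(subrK t s) (le_lt_trans (ler_normD _ _)) // distrC.
by rewrite /N -[X in _ < X]natr1 addrC ltrD.
Unshelve. all: by end_near. Qed.

End Calculus.

(** * Limits at a geometric rate and primitives *)

Section RealLemmas.
Context {R : realType}.

Lemma pow2_gt (n : nat) : n%:R < 2 ^+ n :> R.
Proof. by rewrite -natrX ltr_nat; exact: ltn_expl. Qed.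

Lemma geometric_small (D e : R) : 0 < e -> exists n : nat, D / 2 ^+ n < e.
Proof.
move=> e0; exists (Num.truncn (D / e)).+1.
rewrite ltr_pdivrMr ?exprn_gt0 // mulrC -ltr_pdivrMr //.
by apply: lt_trans (pow2_gt _); exact: truncnS_gt.
Qed.

Lemma le_geometric (x y D : R) : (forall n : nat, x <= y + D / 2 ^+ n) -> x <= y.
Proof.
move=> h; rewrite leNgt; apply/negP; rewrite -subr_gt0.
by move=> /(geometric_small D)[n]; have := h n; lra.
Qed.

Lemma nested_intervals (l r : nat -> R) : (forall n m, l n <= r m) ->
  exists c, forall n, l n <= c <= r n.
Proof.
move=> lr; exists (sup (range l)) => n; apply/andP; split.
  by apply: ub_le_sup; [exists (r 0%N) => _ [m _ <-]|exists n].
by apply: ge_sup; [exists (l 0%N); exists 0%N|move=> _ [m _ <-]].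
Qed.

(** The partial bounds u n -+ 2 D / 2^n form nested intervals. *)
Lemma geometric_limit (u : nat -> R) (D : R) :
  (forall n, `|u n.+1 - u n| <= D / 2 ^+ n) ->
  exists c, forall n, `|u n - c| <= 2 * D / 2 ^+ n.
Proof.
move=> h.
pose l n := u n - 2 * D / 2 ^+ n; pose r n := u n + 2 * D / 2 ^+ n.
have half n : 2 * D / 2 ^+ n.+1 = D / 2 ^+ n.
  by rewrite exprS -mulrA invfM [D * _]mulrCA mulVKf.
have lS n : l n <= l n.+1.
  by have := h n; rewrite /l half ler_norml -mulrA; lra.
have rS n : r n.+1 <= r n.
  by have := h n; rewrite /r half ler_norml -mulrA; lra.
have lm := homo_leq (@lexx _ _) (@le_trans _ _) lS.
have rm : {homo r : n m / (n <= m)%N >-> m <= n}.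
  by apply: homo_leq => // y x z yx zy; exact: le_trans zy yx.
have ln n : l n <= r n.
  by have := le_trans (normr_ge0 _) (h n); rewrite /l /r -mulrA; lra.
have [n m|c hc] := @nested_intervals l r.
  apply: le_trans (lm _ _ (leq_maxl n m)) _.
  by apply: le_trans (ln _) (rm _ _ (leq_maxr n m)).
by exists c => n; have := hc n; rewrite /l /r ler_norml; lra.
Qed.

Lemma continuous_of_lipschitz (f : R -> R) (C : R) :
  (forall s t, `|f s - f t| <= C * `|s - t|) -> continuous f.
Proof.
move=> lf t; apply/cvgrPdist_lt => e e0.
have C0 : 0 < `|C| + 1 by rewrite ltr_wpDl.
near=> s; apply: le_lt_trans (lf _ _) _.
apply: (@le_lt_trans _ _ ((`|C| + 1) * `|t - s|)).
  by rewrite ler_wpM2r // ler_wpDr // ler_norm.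
rewrite mulrC -ltr_pdivlMr //.
by near: s; apply: cvgr_dist_lt; [exact: cvg_id|exact: divr_gt0].
Unshelve. all: by end_near. Qed.

Lemma ler_dist_cos (x y : R) : `|cos x - cos y| <= `|x - y|.
Proof.
wlog xy : x y / x <= y.
  move=> h; have [/h//|/ltW/h] := leP x y.
  by rewrite distrC [X in _ <= X]distrC.
rewrite distrC [X in _ <= X]distrC (ger0_norm (_ : 0 <= y - x)) ?subr_ge0 //.
have dc := hderiv_cos (@hderiv_id R).
have h1 := hderiv_le (hderivN hderiv_id) dc xy; have h2 := hderiv_le dc hderiv_id xy.
have {}h1 : - y - - x <= cos y - cos x.
  by apply: h1 => t _; rewrite mulr1 lerN2 sin_le1.
have {}h2 : cos y - cos x <= y - x.
  by apply: h2 => t _; rewrite mulr1 lerNl sin_geN1.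
by rewrite ler_norml; lra.
Qed.

End RealLemmas.

(** The primitive that vanishes at 0; it serves as the integral of a continuous
    function. *)
Definition prim (R : realType) (g : R -> R) : R -> R :=
  get [set F | F 0 = 0 /\ hderiv F g].

Section Primitive.
Context {R : realType}.
Implicit Types (f g : R -> R).

Lemma primP g : continuous g -> prim g 0 = 0 /\ hderiv (prim g) g.
Proof.
by move=> /(antiderivative 0) [F hF]; exact: (@getI _ [set F | F 0 = 0 /\ hderiv F g] F hF).
Qed.

Lemma prim0 g : continuous g -> prim g 0 = 0.
Proof. by move=> /primP[]. Qed.

Lemma hderiv_prim g : continuous g -> hderiv (prim g) g.
Proof. by move=> /primP[]. Qed.

End Primitive.

(** * Differential inequalities and existence of solutions *)

Section Comparison.
Context {R : realType}.
Implicit Types (d dd u du : R -> R) (K e t : R).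

(** The half square of the negative part is continuously differentiable.  It is
    obtained as a primitive, which settles its derivative at 0; [comparison] feeds it to Gronwall's inequality. *)
Lemma half_square_negative_part :
  exists H : R -> R, [/\ hderiv H (fun x : R => Num.min x 0),
    forall x : R, 0 <= x -> H x = 0 & forall x : R, x <= 0 -> H x = x ^+ 2 / 2].
Proof.
have [|H [H0 dH]] := @antiderivative R (fun x => Num.min x 0) 0.
  by move=> x; apply: continuous_min; [exact: cvg_id|exact: cvg_cst].
have dsq : hderiv (fun x : R => x ^+ 2 / 2) (fun x => x).
  apply: hderiv_congr (hderivZ 2^-1 (hderivM (@hderiv_id R) (@hderiv_id R))) _ _.
    by move=> x; rewrite mulrC.
  by move=> x /=; field.
exists H; split=> // x x0.
  have h1 := hderiv_le dH (hderivC 0) x0; have h2 := hderiv_le (hderivC 0) dH x0.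
  rewrite !H0 in h1 h2; apply/eqP; rewrite eq_le; apply/andP; split.
    by rewrite -[H x]subr0 -[leRHS](subrr 0); apply: h1 => t /andP[t0 _]; rewrite min_r.
  by rewrite -[H x]subr0 -[leLHS](subrr 0); apply: h2 => t /andP[t0 _]; rewrite min_r.
have h1 := hderiv_le dH dsq x0; have h2 := hderiv_le dsq dH x0.
have {}h1 : H 0 - H x <= 0 ^+ 2 / 2 - x ^+ 2 / 2.
  by apply: h1 => t /andP[_ t0]; rewrite min_l.
have {}h2 : 0 ^+ 2 / 2 - x ^+ 2 / 2 <= H 0 - H x.
  by apply: h2 => t /andP[_ t0]; rewrite min_l.
by rewrite H0 expr0n /= in h1 h2; lra.
Qed.

(** The function d t * exp (- K t) is nonincreasing. *)
Lemma gronwall d dd K t : hderiv d dd -> 0 <= t ->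
  (forall s, 0 <= s <= t -> dd s <= K * d s) -> d t <= d 0 * expR (K * t).
Proof.
move=> hd t0 h.
have de : hderiv (fun s => - (d s * expR (- K * s)))
    (fun s => (K * d s - dd s) * expR (- K * s)).
  apply: hderiv_eq (hderivN (hderivM hd (hderiv_expR (hderivZ (- K) hderiv_id)))) _.
  by move=> s /=; ring.
have : - (d 0 * expR (- K * 0)) <= - (d t * expR (- K * t)).
  apply: (hderiv_ge0_le de t0) => s st.
  by rewrite mulr_ge0 ?expR_ge0 // subr_ge0 h.
by rewrite mulr0 expR0 mulr1 lerN2 mulNr expRN ler_pdivrMr // expR_gt0.
Qed.

(** The negative part of d satisfies a Gronwall inequality with zero initial
    value, so d stays nonnegative; then d t * exp (K t) grows at rate at least
    e.  With e = 0 this compares two solutions of one equation, with e > 0 it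
    gives strict monotonicity in the right-hand side. *)
Lemma comparison d dd K e : hderiv d dd -> 0 <= K -> 0 <= e ->
  (forall t, 0 <= t -> e - K * `|d t| <= dd t) -> 0 <= d 0 ->
  forall t, 0 <= t -> 0 <= d t /\ d 0 + e * t <= d t * expR (K * t).
Proof.
move=> hd K0 e0 hdd d0.
have [H [dH H0 Hneg]] := half_square_negative_part.
have dpos t : 0 <= t -> 0 <= d t.
  move=> t0; rewrite leNgt; apply/negP => dt0.
  have := @gronwall _ _ (2 * K) t (hderiv_comp dH hd) t0.
  rewrite (H0 (d 0)) // mul0r (Hneg (d t) (ltW dt0)) => h.
  suff : d t ^+ 2 / 2 <= 0 by nra.
  apply: h => s /andP[s0 _].
  have [ds0|ds0] := leP 0 (d s).
    by rewrite H0 // mul0r mulr0.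
  rewrite (Hneg _ (ltW ds0)).
  have := hdd s s0; rewrite ltr0_norm //.
  nra.
move=> t t0; split; first exact: dpos.
have de : hderiv (fun s => d s * expR (K * s) - e * s)
    (fun s => (dd s + K * d s) * expR (K * s) - e).
  apply: hderiv_eq (hderivB (hderivM hd (hderiv_expR (hderivZ K hderiv_id)))
    (hderivZ e hderiv_id)) _.
  by move=> s /=; ring.
have := hderiv_ge0_le de t0.
rewrite !mulr0 expR0 mulr1 subr0 => h; rewrite -lerBrDr; apply: h => s /andP[s0 _].
have := hdd s s0; rewrite ger0_norm ?dpos // => hs.
have e1 : 1 <= expR (K * s) by rewrite -expR0 ler_expR mulr_ge0.
have : e <= dd s + K * d s by lra.
by nra.
Qed.

(** Squares are used since the absolute value is not differentiable; with e = 0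
    this gives Lipschitz dependence on initial values, with u 0 = 0 Lipschitz
    dependence on parameters. *)
Lemma gronwall_dist u du K e t : hderiv u du -> 0 <= K -> 0 <= t ->
  (forall s, 0 <= s -> `|du s| <= K * `|u s| + e) ->
  u t ^+ 2 + e ^+ 2 <= (u 0 ^+ 2 + e ^+ 2) * expR ((2 * K + 1) * t).
Proof.
move=> hu K0 t0 h.
have de : hderiv (fun s => u s ^+ 2 + e ^+ 2) (fun s => 2 * (u s * du s)).
  apply: hderiv_eq (hderivD (hderivM hu hu) (hderivC (e ^+ 2))) _.
  by move=> s /=; ring.
apply: (gronwall de t0) => s /andP[s0 _].
have : u s * du s <= `|u s| * (K * `|u s| + e).
  by apply: le_trans (ler_norm _) _; rewrite normrM ler_wpM2l // h.
rewrite -(real_normK (num_real (u s))).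
have := mulr_ge0 K0 (sqr_ge0 e); have := sqr_ge0 (`|u s| - e).
by move: `|u s| (u s * du s) => v w; rewrite !expr2; lra.
Qed.

End Comparison.

Definition phase_field (R : realType) (a b : R -> R) (theta t : R) : R :=
  a t * cos theta + b t.

Section Existence.
Context {R : realType}.
Variables (a b : R -> R) (K C : R).
Hypotheses (ca : continuous a) (cb : continuous b).
Hypotheses (aK : forall t, `|a t| <= K) (bC : forall t, `|b t| <= C).

Let lam := 2 * (K + 1).
Let phi (t : R) := expR (lam * t) + expR (- lam * t).
Let sig (t : R) := expR (lam * t) - expR (- lam * t).

Lemma bound_ge0 : 0 <= K. Proof. exact: le_trans (normr_ge0 _) (aK 0). Qed.
Let lam0 : 0 < lam. Proof. by have := bound_ge0; rewrite /lam; lra. Qed.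

Let dsig : hderiv sig (fun t => lam * phi t).
Proof.
rewrite /sig /phi; apply: hderiv_eq (hderivB (hderiv_expR (hderivZ lam hderiv_id))
  (hderiv_expR (hderivZ (- lam) hderiv_id))) _.
by move=> s /=; ring.
Qed.

Let sigle t : `|sig t| <= phi t.
Proof.
rewrite /sig /phi ler_norml; have := expR_gt0 (lam * t).
by have := expR_gt0 (- lam * t); lra.
Qed.

Let phi1 t : 1 <= phi t.
Proof.
rewrite /phi; have [t0|t0] := leP 0 t.
  have : 1 <= expR (lam * t) by rewrite -expR0 ler_expR mulr_ge0 // ltW.
  by have := expR_gt0 (- lam * t); lra.
have : 1 <= expR (- lam * t) by rewrite -expR0 ler_expR mulNr -mulrN mulr_ge0 ?ltW // oppr_gt0.
by have := expR_gt0 (lam * t); lra.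
Qed.

Let weighted_bound (F f : R -> R) (c t : R) : hderiv F f -> F 0 = 0 ->
  (forall s, `|f s| <= c * phi s) -> `|F t| <= c / lam * phi t.
Proof.
move=> dF F0 hf.
have c0 : 0 <= c.
  have := le_trans (normr_ge0 _) (hf 0).
  by rewrite pmulr_lge0 // (lt_le_trans ltr01).
have sig0 : sig 0 = 0 by rewrite /sig !mulr0 subrr.
have ds : hderiv (fun s => c / lam * sig s) (fun s => c * phi s).
  apply: hderiv_eq (hderivZ _ dsig) _ => s.
  by rewrite mulrA divfK ?gt_eqF.
have dsN : hderiv (fun s => - (c / lam * sig s)) (fun s => - (c * phi s)).
  exact: hderivN.
apply: (@le_trans _ _ (`|c / lam * sig t|)); last first.
  by rewrite normrM (ger0_norm (divr_ge0 c0 (ltW lam0))) ler_wpM2l ?divr_ge0 // ltW.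
have lef s : f s <= c * phi s by apply: le_trans (ler_norm _) (hf s).
have gef s : - (c * phi s) <= f s by have := hf s; rewrite ler_norml => /andP[].
have [t0|/ltW t0] := leP 0 t.
  have := hderiv_le dF ds t0 (fun s _ => lef s).
  have := hderiv_le dsN dF t0 (fun s _ => gef s).
  rewrite F0 sig0 => h1 h2; have h : 0 <= c / lam * sig t by lra.
  by rewrite (ger0_norm h) ler_norml; lra.
have := hderiv_le dF ds t0 (fun s _ => lef s).
have := hderiv_le dsN dF t0 (fun s _ => gef s).
rewrite F0 sig0 => h1 h2; have h : c / lam * sig t <= 0 by lra.
by rewrite (ler0_norm h) ler_norml; lra.
Qed.

Let field_continuous (th : R -> R) : continuous th ->
  continuous (fun t => phase_field a b (th t) t).
Proof.
move=> cth t; apply: cvgD; last exact: cb.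
by apply: cvgM; [exact: ca|apply: continuous_comp; [exact: cth|exact: continuous_cos]].
Qed.

Let field_lip (th th' t : R) :
  `|phase_field a b th t - phase_field a b th' t| <= K * `|th - th'|.
Proof.
have -> : phase_field a b th t - phase_field a b th' t = a t * (cos th - cos th').
  by rewrite /phase_field; ring.
by rewrite normrM ler_pM // ler_dist_cos.
Qed.

Lemma field_bound (th t : R) : `|phase_field a b th t| <= K + C.
Proof.
rewrite (le_trans (ler_normD _ _)) // lerD // normrM.
by rewrite -[K]mulr1 ler_pM // cos_max.
Qed.

(** Picard iteration converges on the whole line at once in the distance
    weighted by exp (lam t) + exp (- lam t) with lam = 2 (K + 1), for which
    it is a contraction of ratio 1/2. *)
Lemma solution_exists (x : R) : exists th : R -> R,
  th 0 = x /\ is_solution (phase_field a b) th.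
Proof.
pose T (th : R -> R) t := x + prim (fun t => phase_field a b (th t) t) t.
have dT th : continuous th -> hderiv (T th) (fun t => phase_field a b (th t) t).
  move=> /field_continuous/hderiv_prim h.
  by apply: hderiv_eq (hderivD (hderivC x) h) _ => t; rewrite add0r.
have T0 th : continuous th -> T th 0 = x.
  by move=> /field_continuous/prim0 h; rewrite /T h addr0.
pose th n := iter n T (fun=> x).
have cth n : continuous (th n).
  elim: n => [|n ih]; first exact: cst_continuous.
  exact: hderiv_continuous (dT _ ih).
have C0 : 0 <= K + C by apply: le_trans (normr_ge0 _) (field_bound 0 0).
(* lam is more than twice K, and the primitive of phi is at most phi / lam *)
have contract u v c : continuous u -> continuous v ->
    (forall s, `|u s - v s| <= c * phi s) ->
    forall t, `|T u t - T v t| <= c / 2 * phi t.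
  move=> cu cv uv t.
  have c0 : 0 <= c.
    have := le_trans (normr_ge0 _) (uv 0).
    by rewrite pmulr_lge0 // (lt_le_trans ltr01).
  have h s : `|phase_field a b (u s) s - phase_field a b (v s) s| <= K * c * phi s.
    by rewrite (le_trans (field_lip _ _ _)) // -mulrA ler_wpM2l // bound_ge0.
  have := weighted_bound t (hderivB (dT _ cu) (dT _ cv)) _ h.
  rewrite !T0 // subrr => /(_ erefl) h'; apply: le_trans h' _.
  rewrite ler_wpM2r //; first by rewrite (le_trans ler01).
  rewrite ler_pdivrMr // /lam mulrA divfK // mulrC ler_wpM2l //.
  by rewrite lerDl.
have thS n t : `|th n.+1 t - th n t| <= (K + C) / lam * phi t / 2 ^+ n.
  elim: n t => [|n ih] t.
    rewrite expr0 divr1.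
    apply: (@weighted_bound (fun t => th 1%N t - th 0%N t) (fun s => phase_field a b x s)).
    - have := dT (fun=> x) (@cst_continuous _ _ x).
      by move=> h; apply: hderiv_eq (hderivB h (hderivC x)) _ => s; rewrite subr0.
    - by rewrite /= T0 ?subrr //; exact: cst_continuous.
    - by move=> s; rewrite (le_trans (field_bound _ _)) // ler_peMr.
  have := @contract (th n.+1) (th n) ((K + C) / lam / 2 ^+ n) (cth _) (cth _).
  rewrite exprS [(2 * 2 ^+ n)^-1]invfM => h; apply: le_trans (h _ t) _.
    by move=> s; apply: le_trans (ih s) _; rewrite mulrAC.
  by rewrite le_eqVlt; apply/orP; left; apply/eqP; ring.
have /choice[y hy] : forall t, exists c, forall n,
    `|th n t - c| <= 2 * ((K + C) / lam * phi t) / 2 ^+ n.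
  by move=> t; exact: geometric_limit.
have thlip n s t : `|th n s - th n t| <= (K + C) * `|s - t|.
  case: n => [|n]; first by rewrite subrr normr0 mulr_ge0.
  have dth := dT _ (cth n).
  wlog ts : s t / t <= s.
    by move=> h; have [/h//|/ltW/h] := leP t s; rewrite distrC [X in _ * X]distrC.
  rewrite (ger0_norm (_ : 0 <= s - t)) ?subr_ge0 //.
  have dl := hderivZ (K + C) (@hderiv_id R).
  have bd r := field_bound (th n r) r.
  have h1 := hderiv_le dth dl ts; have h2 := hderiv_le (hderivN dl) dth ts.
  have {}h1 : T (th n) s - T (th n) t <= (K + C) * s - (K + C) * t.
    by apply: h1 => r _; rewrite mulr1; apply: le_trans (ler_norm _) (bd r).
  have {}h2 : - ((K + C) * s) - - ((K + C) * t) <= T (th n) s - T (th n) t.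
    by apply: h2 => r _; rewrite mulr1; have := bd r; rewrite ler_norml => /andP[].
  by rewrite /= ler_norml; lra.
have ylip s t : `|y s - y t| <= (K + C) * `|s - t|.
  apply: (@le_geometric _ _ _ (2 * ((K + C) / lam * phi s) + 2 * ((K + C) / lam * phi t))).
  move=> n; have := hy s n; have := hy t n; have := thlip n s t.
  rewrite !ler_norml mulrDl; lra.
have cy := continuous_of_lipschitz ylip.
have yT t : T y t = y t.
  apply/eqP; rewrite -subr_eq0 -normr_eq0 eq_le normr_ge0 andbT.
  apply: (@le_geometric _ _ _ (2 * ((K + C) / lam * phi t) / 2
     + 2 * ((K + C) / lam * phi t) / 2)) => n; rewrite add0r.
  have h1 := hy t n.+1.
  have := @contract y (th n) (2 * ((K + C) / lam) / 2 ^+ n) cy (cth _).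
  move=> /(_ _ t) h2.
  rewrite exprS [(2 * 2 ^+ n)^-1]invfM in h1.
  have {}h2 : `|T y t - T (th n) t| <= 2 * ((K + C) / lam) / 2 ^+ n / 2 * phi t.
    by apply: h2 => s; rewrite distrC (le_trans (hy s n)) // mulrA mulrAC.
  rewrite -(subrK (T (th n) t) (T y t)) -addrA (le_trans (ler_normD _ _)) //.
  apply: le_trans (lerD h2 h1) _.
  by rewrite le_eqVlt; apply/orP; left; apply/eqP; field; rewrite expf_neq0 // gt_eqF.
exists y; split; first by rewrite -yT T0.
move=> t; have := dT _ cy t.
by rewrite (_ : T y = y) //; apply/funext.
Qed.

End Existence.

(** * Period map and rotation number *)

Local Notation tau := (pi *+ 2).

Section Periodicity.
Context {R : realType}.

Lemma tau_gt0 : 0 < tau :> R.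
Proof. by rewrite pmulrn_lgt0 // pi_gt0. Qed.

Lemma tau_neq0 : tau != 0 :> R.
Proof. by rewrite gt_eqF // tau_gt0. Qed.

Lemma period_cell (x y : R) :
  exists k : int, y + tau * k%:~R <= x < y + tau * (k + 1)%:~R.
Proof.
exists (Num.floor ((x - y) / tau)).
have /andP[h1 h2] := floor_itv ((x - y) / tau).
rewrite -lerBrDl -ltrBlDl mulrC -ler_pdivlMr ?tau_gt0 // h1 /=.
by rewrite mulrC -ltr_pdivrMr ?tau_gt0.
Qed.

Lemma periodicz (f : R -> R) : periodic f tau ->
  forall (k : int) t, f (t + tau * k%:~R) = f t.
Proof.
move=> pf [n|n] t; first by rewrite mulrzr; exact: (periodicn pf).
by rewrite mulrzr -{2}(subrK (tau *+ n.+1) t) (periodicn pf).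
Qed.

Lemma periodic_bounded (f : R -> R) : continuous f -> periodic f tau ->
  exists M, forall t, `|f t| <= M.
Proof.
move=> cf pf.
have [|c _ hc] := @EVT_max R (fun t => `|f t|) 0 tau (ltW tau_gt0).
  apply: continuous_subspaceT => t; apply: continuous_comp; first exact: cf.
  exact: norm_continuous.
exists `|f c| => t; have [k /andP[h1 h2]] := period_cell t 0.
rewrite -(subrK (tau * k%:~R) t) (periodicz pf); apply: hc.
rewrite in_itv /=; apply/andP; split; first by lra.
by move: h2; rewrite intrD mulrDr mulr1; lra.
Qed.

End Periodicity.

Definition flow (R : realType) (a b : R -> R) (x : R) : R -> R :=
  get [set th | th 0 = x /\ is_solution (phase_field a b) th].

Definition poincare (R : realType) (a b : R -> R) (x : R) : R := flow a b x tau.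

Section Flow.
Context {R : realType}.
Variables (a b : R -> R).
Hypotheses (ca : continuous a) (cb : continuous b).
Hypotheses (pa : periodic a tau) (pb : periodic b tau).

Local Notation f := (phase_field a b).
Local Notation P := (poincare a b).

Lemma flowP x : flow a b x 0 = x /\ is_solution f (flow a b x).
Proof.
have [K aK] := periodic_bounded ca pa; have [C bC] := periodic_bounded cb pb.
have [th hth] := solution_exists ca cb aK bC x.
exact: (@getI _ [set th | th 0 = x /\ is_solution f th] th hth).
Qed.

Lemma flow0 x : flow a b x 0 = x. Proof. exact: (flowP x).1. Qed.
Lemma flow_solution x : is_solution f (flow a b x). Proof. exact: (flowP x).2. Qed.

Lemma solution_hderiv th : is_solution f th -> hderiv th (fun t => f (th t) t).
Proof. by []. Qed.

Lemma field_lipschitz K x y t : (forall t, `|a t| <= K) ->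
  `|f x t - f y t| <= K * `|x - y|.
Proof.
move=> aK; have -> : f x t - f y t = a t * (cos x - cos y) by rewrite /phase_field; ring.
by rewrite normrM ler_pM // ler_dist_cos.
Qed.

Lemma solution_lipschitz_initial t : 0 <= t -> exists E, 
  forall th1 th2, is_solution f th1 -> is_solution f th2 ->
  `|th1 t - th2 t| <= E * `|th1 0 - th2 0|.
Proof.
move=> t0; have [K aK] := periodic_bounded ca pa.
have K0 : 0 <= K := bound_ge0 aK.
exists (expR ((2 * K + 1) * t)) => th1 th2 s1 s2.
have := gronwall_dist (hderivB (solution_hderiv s1) (solution_hderiv s2)) K0 t0.
move=> /(_ 0); rewrite expr0n /= !addr0 => h.
have E1 : 1 <= expR ((2 * K + 1) * t) by rewrite -expR0 ler_expR mulr_ge0 // addr_ge0 // mulr_ge0.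
rewrite -(@ler_pXn2r _ 2) ?nnegrE ?mulr_ge0 // ?expR_ge0 //.
rewrite exprMn !real_normK ?num_real //.
apply: le_trans (h _) _.
  by move=> s _; rewrite addr0; exact: field_lipschitz.
rewrite mulrC ler_wpM2r ?sqr_ge0 // expr2.
by rewrite ler_peMl // expR_ge0.
Qed.

Lemma solution_unique th1 th2 : is_solution f th1 -> is_solution f th2 ->
  th1 0 = th2 0 -> forall t, 0 <= t -> th1 t = th2 t.
Proof.
move=> s1 s2 e t /solution_lipschitz_initial[E /(_ th1 th2 s1 s2)].
by rewrite e subrr normr0 mulr0 normr_le0 subr_eq0 => /eqP.
Qed.

Lemma solution_lt th1 th2 : is_solution f th1 -> is_solution f th2 ->
  th1 0 < th2 0 -> forall t, 0 <= t -> th1 t < th2 t.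
Proof.
move=> s1 s2 lt0 t t0; have [K aK] := periodic_bounded ca pa.
have h0 s : 0 <= s -> 0 - K * `|th2 s - th1 s| <= f (th2 s) s - f (th1 s) s.
  rewrite sub0r => _; have := field_lipschitz (th2 s) (th1 s) s aK.
  by rewrite ler_norml => /andP[].
have d0 : 0 <= th2 0 - th1 0 by rewrite subr_ge0 ltW.
have [_] := comparison (hderivB s2 s1) (bound_ge0 aK) (lexx 0) h0 d0 t0.
rewrite mul0r addr0 => h.
have : 0 < (th2 t - th1 t) * expR (K * t) by apply: lt_le_trans h; rewrite subr_gt0.
by rewrite pmulr_lgt0 ?expR_gt0 // subr_gt0.
Qed.

Lemma solutionDtau th (k : int) : is_solution f th ->
  is_solution f (fun t => th t + tau * k%:~R).
Proof.
move=> s; apply: hderiv_eq (hderivD (solution_hderiv s) (hderivC _)) _ => t.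
by rewrite /phase_field addr0 (periodicz (@cosD2pi R)).
Qed.

Lemma solution_shift th : is_solution f th -> is_solution f (fun t => th (t + tau)).
Proof.
move=> s; apply: hderiv_eq (hderiv_shift tau (solution_hderiv s)) _ => t.
by rewrite /phase_field pa pb.
Qed.

Lemma poincareE th : is_solution f th -> th tau = P (th 0).
Proof.
move=> s; apply: solution_unique s (flow_solution _) _ _ (ltW tau_gt0).
by rewrite flow0.
Qed.

Lemma poincare_lt : {homo P : x y / x < y}.
Proof.
move=> x y xy.
apply: (solution_lt (flow_solution x) (flow_solution y) _ (ltW tau_gt0)).
by rewrite !flow0.
Qed.

Lemma poincare_le : {homo P : x y / x <= y}.
Proof.
by move=> x y; rewrite le_eqVlt => /predU1P[->//|/poincare_lt/ltW].
Qed.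

Lemma poincareDtau (k : int) x : P (x + tau * k%:~R) = P x + tau * k%:~R.
Proof.
have := poincareE (solutionDtau k (flow_solution x)).
by rewrite /= flow0 => <-.
Qed.

Lemma poincare_continuous : continuous P.
Proof.
have [E hE] := solution_lipschitz_initial (ltW tau_gt0).
apply: (@continuous_of_lipschitz _ _ E) => x y.
have := hE _ _ (flow_solution x) (flow_solution y).
by rewrite !flow0.
Qed.

Lemma solution_iter th : is_solution f th ->
  forall n, th (tau *+ n) = iter n P (th 0).
Proof.
move=> s n; elim: n th s => [|n ih] th s; first by rewrite mulr0n.
by rewrite iterSr -poincareE // mulrSr (ih (fun t => th (t + tau))) ?add0r //; exact: solution_shift.
Qed.

Lemma iter_poincare_le n : {homo iter n P : x y / x <= y}.
Proof. by elim: n => [//|n ih] x y /ih/poincare_le. Qed.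

Lemma iter_poincareDtau n (k : int) x :
  iter n P (x + tau * k%:~R) = iter n P x + tau * k%:~R.
Proof. by elim: n => [//|n ih]; rewrite !iterS ih poincareDtau. Qed.

(** As P commutes with the translations by 2 pi k, two points in a common cell
    stay in a common cell. *)
Lemma displacement_spread n x y :
  `|(iter n P x - x) - (iter n P y - y)| <= tau.
Proof.
have [k /andP[h1 h2]] := period_cell x y.
have := iter_poincare_le n h1; have := iter_poincare_le n (ltW h2).
rewrite !iter_poincareDtau; move: h2; rewrite intrD mulrDr mulr1 => h2.
by rewrite ler_norml; lra.
Qed.

(** By [displacement_spread] the sequence of the P^n(0) is additive up to 2 pi,
    so the intervals [(P^n(0) - 2 pi) / (2 pi n), (P^n(0) + 2 pi) / (2 pi n)] meet. *)
Lemma translation_number : exists rho : R, forall n,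
  `|iter n P 0 - tau * rho * n%:R| <= tau.
Proof.
pose s n := iter n P 0.
have sD n m : `|s (n + m)%N - s n - s m| <= tau.
  have := displacement_spread m (s n) 0; rewrite subr0 => h.
  by rewrite /s addnC iterD.
have sM n m : `|s (m * n)%N - m%:R * s n| <= m%:R * tau.
  elim: m => [|m ih]; first by rewrite mul0n !mul0r subr0 normr0.
  have := sD (m * n)%N n; rewrite mulSn addnC => h; move: h ih.
  by rewrite -[m.+1%:R]natr1 !ler_norml; lra.
have [|rho hrho] := @nested_intervals R (fun n => (s n.+1 - tau) / (tau * n.+1%:R))
    (fun n => (s n.+1 + tau) / (tau * n.+1%:R)).
  move=> n m.
  have tn k : 0 < tau * k.+1%:R :> R by rewrite mulr_gt0 ?tau_gt0.
  rewrite ler_pdivrMr ?tn // mulrAC ler_pdivlMr ?tn //.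
  rewrite !mulrA ![_ * tau]mulrC -!mulrA ler_pM2l ?tau_gt0 //.
  have := sM n.+1 m.+1; have := sM m.+1 n.+1; rewrite mulnC !ler_norml.
  by lra.
exists rho => -[|n]; first by rewrite mulr0 subr0 normr0 ltW // tau_gt0.
have tn : 0 < tau * n.+1%:R :> R by rewrite mulr_gt0 ?tau_gt0.
have := hrho n; rewrite ler_pdivrMr // ler_pdivlMr // => /andP[h1 h2].
by rewrite -/(s _) ler_norml; lra.
Qed.

Lemma solution_rotates : exists rho : R, forall th, is_solution f th ->
  exists c, forall T, 0 <= T -> `|th T - rho * T| <= c.
Proof.
have [rho hrho] := translation_number; exists rho => th s.
have [K aK] := periodic_bounded ca pa; have [C bC] := periodic_bounded cb pb.
pose M := K + C.
have fM x t : `|f x t| <= M by exact: field_bound.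
have M0 : 0 <= M by apply: le_trans (normr_ge0 _) (fM 0 0).
exists (tau + tau + `|th 0| + M * tau + `|rho| * tau) => T T0.
pose n := Num.truncn (T / tau).
have /andP[n1 n2] : n%:R <= T / tau < n.+1%:R.
  by apply: truncn_itv; rewrite divr_ge0 // ltW // tau_gt0.
rewrite ler_pdivlMr ?tau_gt0 // in n1; rewrite ltr_pdivrMr ?tau_gt0 // in n2.
have h1 : `|th (tau *+ n) - th 0 - iter n P 0| <= tau.
  by have := displacement_spread n (th 0) 0; rewrite -solution_iter // subr0.
have h2 := hrho n.
have e : tau *+ n = n%:R * tau :> R by rewrite mulr_natl.
rewrite -natr1 mulrDl mul1r in n2.
have h3 : `|th T - th (tau *+ n)| <= M * tau.
  have nT : tau *+ n <= T by rewrite e.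
  have dl := hderivZ M (@hderiv_id R).
  have {}h1 := hderiv_le (solution_hderiv s) dl nT.
  have {}h2 := hderiv_le (hderivN dl) (solution_hderiv s) nT.
  have {}h1 : th T - th (tau *+ n) <= M * T - M * (tau *+ n).
    by apply: h1 => r _; rewrite mulr1; apply: le_trans (ler_norm _) (fM _ r).
  have {}h2 : - (M * T) - - (M * (tau *+ n)) <= th T - th (tau *+ n).
    by apply: h2 => r _; rewrite mulr1; have := fM (th r) r; rewrite ler_norml => /andP[].
  have : M * (T - tau *+ n) <= M * tau by rewrite ler_wpM2l // e; lra.
  by rewrite ler_norml; lra.
have h4 : `|rho * (T - n%:R * tau)| <= `|rho| * tau.
  by rewrite normrM ler_wpM2l // ger0_norm; lra.
have -> : th T - rho * T = (th T - th (tau *+ n)) + (th (tau *+ n) - th 0 - iter n P 0)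
   + (iter n P 0 - tau * rho * n%:R) + th 0 - rho * (T - n%:R * tau).
  by ring.
apply: le_trans (ler_normB _ _) _.
apply: le_trans (lerD (ler_normD _ _) h4) _; rewrite lerD2r.
apply: le_trans (lerD (ler_normD _ _) (lexx _)) _.
apply: le_trans (lerD (lerD (ler_normD _ _) (lexx _)) (lexx _)) _.
by lra.
Qed.

Lemma bounded_deviation_cvg (th : R -> R) rho c :
  (forall T, 0 <= T -> `|th T - rho * T| <= c) -> th T / T @[T --> +oo] --> rho.
Proof.
move=> h; apply/cvgrPdist_lt => e e0.
have c0 : 0 <= c by apply: le_trans (normr_ge0 _) (h 0 (lexx 0)).
near=> T.
have T0 : 0 < T by near: T; exact: nbhs_pinfty_gt.
have -> : rho - th T / T = - ((th T - rho * T) / T) by field; rewrite gt_eqF.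
rewrite normrN normrM normfV (gtr0_norm T0) ltr_pdivrMr //.
apply: le_lt_trans (h T (ltW T0)) _; rewrite mulrC -ltr_pdivrMr //.
by near: T; apply: nbhs_pinfty_gt; rewrite num_real.
Unshelve. all: by end_near. Qed.

(** All solutions stay at bounded distance from the line of slope the rotation
    number: this is stronger than the convergence in its definition and is
    what the estimates below use. *)
Lemma rotation_numberP th : is_solution f th ->
  exists c, forall T, 0 <= T -> `|th T - rotation_number f * T| <= c.
Proof.
have [rho hrho] := solution_rotates; move=> s.
suff -> : rotation_number f = rho by exact: hrho.
have [c0 h0] := hrho _ (flow_solution 0).
have ex : [set rho | exists2 th : R -> R, is_solution f th &
    th T / T @[T --> +oo] --> rho] rho.
  exists (flow a b 0); first exact: flow_solution.
  exact: bounded_deviation_cvg h0.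
have [th' s' hth'] := @getI _ _ rho ex.
have [c hc] := hrho _ s'.
have hrho' := bounded_deviation_cvg hc.
have h1 := cvg_lim (@norm_hausdorff _ _) hrho'.
by have := cvg_lim (@norm_hausdorff _ _) hth'; rewrite h1 => ->.
Qed.

Lemma linear_le_bounded (z c : R) : (forall n, z * n%:R <= c) -> z <= 0.
Proof.
move=> h; rewrite leNgt; apply/negP => z0.
have := h (Num.truncn (c / z)).+1; rewrite mulrC -ler_pdivlMr // leNgt.
by rewrite truncnS_gt.
Qed.

Lemma rotation_number_ge rho : (forall x, x + tau * rho <= P x) ->
  rho <= rotation_number f.
Proof.
move=> h; have [c hc] := rotation_numberP (flow_solution 0).
have hn n : tau * rho * n%:R <= iter n P 0.
  elim: n => [|n ih]; first by rewrite mulr0.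
  by rewrite iterS; have := h (iter n P 0); rewrite -natr1; lra.
rewrite -subr_le0 -(pmulr_rle0 _ tau_gt0); apply: (@linear_le_bounded _ c) => n.
have := hc (tau *+ n); rewrite solution_iter; last exact: flow_solution.
rewrite flow0 mulrn_wge0 ?(ltW tau_gt0) // => /(_ isT).
have := hn n; rewrite -[tau *+ n]mulr_natl ler_norml; lra.
Qed.

Lemma rotation_number_le rho : (forall x, P x <= x + tau * rho) ->
  rotation_number f <= rho.
Proof.
move=> h; have [c hc] := rotation_numberP (flow_solution 0).
have hn n : iter n P 0 <= tau * rho * n%:R.
  elim: n => [|n ih]; first by rewrite mulr0.
  by rewrite iterS; have := h (iter n P 0); rewrite -natr1; lra.
rewrite -subr_le0 -(pmulr_rle0 _ tau_gt0); apply: (@linear_le_bounded _ c) => n.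
have := hc (tau *+ n); rewrite solution_iter; last exact: flow_solution.
rewrite flow0 mulrn_wge0 ?(ltW tau_gt0) // => /(_ isT).
have := hn n; rewrite -[tau *+ n]mulr_natl ler_norml; lra.
Qed.

(** P x - x is continuous and 2 pi-periodic. *)
Lemma displacement_extrema : exists m M : R,
  [/\ exists x, P x = x + m, exists x, P x = x + M
    & forall x, x + m <= P x <= x + M].
Proof.
have cd : {within `[0, tau], continuous (fun x => P x - x)}.
  apply: continuous_subspaceT => x.
  by apply: cvgB; [exact: poincare_continuous|exact: cvg_id].
have [x0 _ h0] := EVT_min (ltW tau_gt0) cd.
have [x1 _ h1] := EVT_max (ltW tau_gt0) cd.
exists (P x0 - x0), (P x1 - x1); split; [by exists x0; ring|by exists x1; ring|].
move=> x; have [k /andP[k0 k1]] := period_cell x 0.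
rewrite intrD mulrDr mulr1 in k1.
have xk : x - tau * k%:~R \in `[0, tau] by rewrite in_itv /=; lra.
have := h0 _ xk; have := h1 _ xk.
have := poincareDtau k (x - tau * k%:~R); rewrite subrK => ->.
by lra.
Qed.

Lemma poincare_ivt c : (exists x, P x <= x + c) -> (exists x, x + c <= P x) ->
  exists x, P x = x + c.
Proof.
move=> [x0 e0] [x1 e1].
have x01 : Num.min x0 x1 <= Num.max x0 x1 by rewrite ge_min !le_max lexx.
have cd : {within `[Num.min x0 x1, Num.max x0 x1], continuous (fun x => P x - x)}.
  apply: continuous_subspaceT => x.
  by apply: cvgB; [exact: poincare_continuous|exact: cvg_id].
have [|x _ ex] := @IVT R _ _ _ c x01 cd.
  have d0 : P x0 - x0 <= c by rewrite lerBlDl.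
  have d1 : c <= P x1 - x1 by rewrite lerBrDl.
  by case: (leP x0 x1) => _; rewrite ge_min le_max d0 d1 ?orbT.
by exists x; rewrite -ex; ring.
Qed.

(** Without a solution x, the displacement P x - x is bounded away from 2 pi k on
    one side by [displacement_extrema]; with one, the orbit of x can be computed. *)
Lemma rotation_number_int (k : int) :
  rotation_number f = k%:~R <-> exists x, P x = x + tau * k%:~R.
Proof.
have [m [M [[x0 e0] [x1 e1] mM]]] := displacement_extrema.
have ge : m / tau <= rotation_number f.
  by apply: rotation_number_ge => x; rewrite mulrC divfK ?tau_neq0 //; case/andP: (mM x).
have le : rotation_number f <= M / tau.
  by apply: rotation_number_le => x; rewrite mulrC divfK ?tau_neq0 //; case/andP: (mM x).
split=> [e|[x e]].
  rewrite e ler_pdivrMr ?tau_gt0 // mulrC in ge.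
  rewrite e ler_pdivlMr ?tau_gt0 // mulrC in le.
  by apply: poincare_ivt; [exists x0|exists x1]; rewrite ?e0 ?e1 lerD2l.
have [c hc] := rotation_numberP (flow_solution x).
have hn n : iter n P x = x + tau * k%:~R * n%:R.
  elim: n => [|n ih]; first by rewrite mulr0 addr0.
  rewrite iterS ih -natr1.
  have -> : x + tau * k%:~R * n%:R = x + tau * (k * n%:Z)%:~R by rewrite intrM mulrA.
  by rewrite poincareDtau e intrM /=; ring.
have hb n : `|x + tau * (k%:~R - rotation_number f) * n%:R| <= c.
  have := hc (tau *+ n); rewrite solution_iter; last exact: flow_solution.
  rewrite flow0 mulrn_wge0 ?(ltW tau_gt0) // => /(_ isT).
  rewrite hn -[tau *+ n]mulr_natl.
  by congr (`|_| <= _); ring.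
apply/eqP; rewrite eq_le -subr_le0 -[X in _ && X]subr_le0.
rewrite -(pmulr_rle0 _ tau_gt0) -[X in _ && X](pmulr_rle0 _ tau_gt0).
by apply/andP; split; apply: (@linear_le_bounded _ (c + `|x|)) => n;
  have := hb n; have := ler_norm x; have := ler_norm (- x);
  rewrite normrN ler_norml; lra.
Qed.

End Flow.

(** * The linear system behind the phase equation *)

(** Two vectors of polar half-angles x / 2 and y / 2 are parallel exactly when
    x - y is a multiple of 2 pi; this is how fixed points of P modulo 2 pi are
    read off from the linear system. *)
Lemma sin_half_eq0 (R : realType) (z : R) :
  sin (z / 2) = 0 -> exists k : int, z = tau * k%:~R.
Proof.
have [k /andP[k0 k1]] := period_cell (z / 2) 0.
rewrite -[z / 2](subrK (tau * k%:~R)) (periodicz (@sinD2pi R)).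
rewrite intrD mulrDr mulr1 in k1.
set w := z / 2 - tau * k%:~R => w0.
have w1 : 0 <= w < tau by rewrite /w; lra.
have : w = 0 \/ w = pi.
  have [wpi|wpi|->] := ltgtP w pi; [left|exfalso|by right].
    apply/eqP; rewrite eq_le (andP w1).1 andbT leNgt; apply/negP => wpos.
    by have := @sin_gt0_pi R w; rewrite w0 ltxx wpos wpi => /(_ isT).
  have := @sin_gt0_pi R (w - pi); rewrite subr_gt0 wpi ltrBlDr -mulr2n (andP w1).2.
  by rewrite -[w](subrK pi) sinDpi in w0; move: w0; move/eqP; rewrite oppr_eq0 => /eqP -> /(_ isT); rewrite ltxx.
move=> [] e; [exists (2 * k)|exists (2 * k + 1)]; rewrite ?intrD intrM;
  move: e; rewrite /w => e.
- have -> : z = 2 * (z / 2) by field.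
  by rewrite (_ : z / 2 = tau * k%:~R); [ring|lra].
- have -> : z = 2 * (z / 2) by field.
  by rewrite (_ : z / 2 = pi + tau * k%:~R); [rewrite -mulr_natl; ring|lra].
Qed.

Definition linear_solution (R : realType) (a b X Y : R -> R) : Prop :=
  hderiv X (fun t => (a t - b t) / 2 * Y t) /\
  hderiv Y (fun t => (a t + b t) / 2 * X t).

(** The length of the solution of the linear system whose direction at time t
    has angle th t / 2. *)
Definition amplitude (R : realType) (a th : R -> R) (t : R) : R :=
  expR (prim (fun s => a s * sin (th s) / 2) t).

Section Linear.
Context {R : realType}.
Variables (a b : R -> R).
Hypotheses (ca : continuous a) (cb : continuous b).
Local Notation f := (phase_field a b).

Lemma amplitude_gt0 th t : 0 < amplitude a th t.
Proof. exact: expR_gt0. Qed.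

Let amplitude_rate_continuous th : is_solution f th ->
  continuous (fun s => a s * sin (th s) / 2).
Proof.
move=> s t; apply: cvgMl; apply: cvgM; first exact: ca.
apply: continuous_comp; last exact: continuous_sin.
exact: hderiv_continuous (solution_hderiv s) t.
Qed.

Lemma amplitude0 th : is_solution f th -> amplitude a th 0 = 1.
Proof.
by move=> s; rewrite /amplitude prim0 ?expR0 //; exact: amplitude_rate_continuous s.
Qed.

Lemma hderiv_amplitude th : is_solution f th ->
  hderiv (amplitude a th) (fun t => amplitude a th t * (a t * sin (th t) / 2)).
Proof.
by move=> s; apply: hderiv_expR; apply: hderiv_prim; exact: amplitude_rate_continuous s.
Qed.

Lemma polar_linear_solution th : is_solution f th ->
  linear_solution a b (fun t => amplitude a th t * cos (th t / 2))
                      (fun t => amplitude a th t * sin (th t / 2)).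
Proof.
move=> s; have dr := hderiv_amplitude s.
have dh : hderiv (fun t => th t / 2) (fun t => f (th t) t / 2).
  apply: hderiv_congr (hderivZ 2^-1 (solution_hderiv s)) _ _ => t;
  by rewrite mulrC.
have s2 t : sin (th t) = 2 * (cos (th t / 2) * sin (th t / 2)).
  by rewrite mulr_natl -sin_mulr2n; congr sin; field.
have c2 t : cos (th t) = cos (th t / 2) ^+ 2 - sin (th t / 2) ^+ 2.
  rewrite {1}(_ : th t = (th t / 2) *+ 2); last by field.
  by rewrite cos_mulr2n; have := cos2Dsin2 (th t / 2); lra.
split.
- apply: hderiv_eq (hderivM dr (hderiv_cos dh)) _ => t.
  rewrite /phase_field s2 c2.
  have -> : (a t - b t) / 2 = (a t * (cos (th t / 2) ^+ 2 + sin (th t / 2) ^+ 2) - b t) / 2.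
    by rewrite cos2Dsin2 mulr1.
  by field.
- apply: hderiv_eq (hderivM dr (hderiv_sin dh)) _ => t.
  rewrite /phase_field s2 c2.
  have -> : (a t + b t) / 2 = (a t * (cos (th t / 2) ^+ 2 + sin (th t / 2) ^+ 2) + b t) / 2.
    by rewrite cos2Dsin2 mulr1.
  by field.
Qed.

(** The linear system has trace zero. *)
Lemma wronskian_cst X1 Y1 X2 Y2 : linear_solution a b X1 Y1 ->
  linear_solution a b X2 Y2 ->
  forall s t, X1 s * Y2 s - Y1 s * X2 s = X1 t * Y2 t - Y1 t * X2 t.
Proof.
move=> [dX1 dY1] [dX2 dY2] s t.
apply: (hderiv0_cst s t (f := fun t => X1 t * Y2 t - Y1 t * X2 t)).
apply: hderiv_eq (hderivB (hderivM dX1 dY2) (hderivM dY1 dX2)) _ => r.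
by ring.
Qed.

Lemma linear_solutionB X1 Y1 X2 Y2 c : linear_solution a b X1 Y1 ->
  linear_solution a b X2 Y2 ->
  linear_solution a b (fun t => X1 t - c * X2 t) (fun t => Y1 t - c * Y2 t).
Proof.
move=> [dX1 dY1] [dX2 dY2]; split.
- by apply: hderiv_eq (hderivB dX1 (hderivZ c dX2)) _ => t; ring.
- by apply: hderiv_eq (hderivB dY1 (hderivZ c dY2)) _ => t; ring.
Qed.

Lemma linear_solution_shift X Y : periodic a tau -> periodic b tau ->
  linear_solution a b X Y ->
  linear_solution a b (fun t => X (t + tau)) (fun t => Y (t + tau)).
Proof.
move=> pa pb [dX dY]; split.
- by apply: hderiv_eq (hderiv_shift tau dX) _ => t; rewrite pa pb.
- by apply: hderiv_eq (hderiv_shift tau dY) _ => t; rewrite pa pb.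
Qed.

End Linear.

Lemma half_angle_exists (R : realType) (u v : R) :
  exists x, u * sin (x / 2) - v * cos (x / 2) = 0.
Proof.
have [->|u0] := eqVneq u 0.
  by exists pi; rewrite cos_pihalf mul0r mulr0 subrr.
exists (2 * atan (v / u)); rewrite mulrAC divff // mul1r.
have c0 : cos (atan (v / u)) != 0.
  by rewrite gt_eqF // cos_gt0_pihalf // atan_gtNpi2 atan_ltpi2.
have := atanK (v / u); rewrite /tan => /(canRL (divfK c0)) ->.
by field.
Qed.

Section Amplitude.
Context {R : realType}.
Variables (a b : R -> R).
Hypotheses (ca : continuous a) (cb : continuous b).
Hypotheses (pa : periodic a tau) (pb : periodic b tau).
Variable k : int.
Hypothesis trivial_poincare : forall x, poincare a b x = x + tau * k%:~R.
Local Notation f := (phase_field a b).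

Let amp x := amplitude a (flow a b x) tau.

Let amp_pair x y : sin ((y - x) / 2) != 0 -> amp x * amp y = 1.
Proof.
move=> s0; have sx := flow_solution ca cb pa pb x; have sy := flow_solution ca cb pa pb y.
have := wronskian_cst (polar_linear_solution ca sx) (polar_linear_solution ca sy) tau 0.
rewrite (amplitude0 ca sx) (amplitude0 ca sy) !(flow0 ca cb pa pb).
rewrite -/(amp x) -/(amp y) -/(poincare a b x) -/(poincare a b y) !trivial_poincare !mul1r.
set X := (x + _) / 2; set Y := (y + _) / 2 => e.
have eXY : Y - X = (y - x) / 2 by rewrite /X /Y; field.
apply: (mulIf s0); rewrite mul1r -{1}eXY [in LHS]sinB mulrBl [in RHS]sinB.
by move: e; rewrite ![cos _ * sin _]mulrC; lra.
Qed.

(** For two solutions the constant Wronskian is the product of their amplitudes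
    times the sine of half their distance, so the product of two amplitudes at
    time 2 pi is 1.  Three solutions then force each amplitude to be 1. *)
Lemma amplitude_tau x : amplitude a (flow a b x) tau = 1.
Proof.
have s4 z : 0 < z < pi -> sin z != 0 by move=> /sin_gt0_pi; move=> h; rewrite gt_eqF.
have p0 := @pi_gt0 R.
have e1 : amp x * amp (x + pi / 2) = 1.
  by apply: amp_pair; rewrite s4 //; lra.
have e2 : amp (x + pi / 2) * amp (x + pi) = 1.
  by apply: amp_pair; rewrite s4 //; lra.
have e3 : amp x * amp (x + pi) = 1.
  by apply: amp_pair; rewrite s4 //; lra.
have g0 : 0 < amp x := amplitude_gt0 _ _ _.
have sq : amp x ^+ 2 = 1.
  have : amp x ^+ 2 * (amp (x + pi / 2) * amp (x + pi)) = 1.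
    transitivity ((amp x * amp (x + pi / 2)) * (amp x * amp (x + pi))); first by ring.
    by rewrite e1 e3 mulr1.
  by rewrite e2 mulr1.
by apply/eqP; move/eqP: sq; rewrite sqrf_eq1 => /orP[//|/eqP e]; move: g0; rewrite e ltr0N1.
Qed.

End Amplitude.

Section Elliptic.
Context {R : realType}.
Variables (a b : R -> R).
Hypotheses (ca : continuous a) (cb : continuous b).
Hypotheses (pa : periodic a tau) (pb : periodic b tau).
Hypothesis no_fixed_point :
  forall (k : int) x, poincare a b x != x + tau * k%:~R.
Local Notation f := (phase_field a b).

Variables (X Y : R -> R).
Hypothesis XY : linear_solution a b X Y.
Local Notation q := (X 0 * Y (0 + tau) - Y 0 * X (0 + tau)).
Hypothesis q_neq0 : q != 0.

Let XYs := linear_solution_shift pa pb XY.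
Let XYss := linear_solution_shift pa pb XYs.
Let tr := (X 0 * Y (0 + tau + tau) - Y 0 * X (0 + tau + tau)) / q.

Let cayley t : X (t + tau + tau) = tr * X (t + tau) - X t /\
  Y (t + tau + tau) = tr * Y (t + tau) - Y t.
Proof.
set Q := q; have Q0 : Q != 0 by [].
have e1 : X t * Y (t + tau) - Y t * X (t + tau) = Q := wronskian_cst XY XYs t 0.
have e2 : X t * Y (t + tau + tau) - Y t * X (t + tau + tau) =
  X 0 * Y (0 + tau + tau) - Y 0 * X (0 + tau + tau) := wronskian_cst XY XYss t 0.
have e3 : X (t + tau) * Y (t + tau + tau) - Y (t + tau) * X (t + tau + tau) = Q.
  exact: wronskian_cst XY XYs (t + tau) 0.
have etr : tr * Q = X t * Y (t + tau + tau) - Y t * X (t + tau + tau).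
  by rewrite e2 /tr divfK.
have expand (z z1 : R) : (tr * z1 - z) * Q = z1 * (tr * Q) - z * Q by ring.
by split; apply: (mulIf Q0); rewrite expand etr -{1}e1 -e3; ring.
Qed.

Let tr_lt4 : tr ^+ 2 < 4.
Proof.
rewrite ltNge; apply/negP => h.
(* l is a real eigenvalue of the monodromy and (W1, W2) an eigenvector *)
have [l hl] : exists l, l ^+ 2 - tr * l + 1 = 0.
  exists ((tr + Num.sqrt (tr ^+ 2 - 4)) / 2).
  have : Num.sqrt (tr ^+ 2 - 4) ^+ 2 = tr ^+ 2 - 4 by rewrite sqr_sqrtr // subr_ge0.
  by move: (Num.sqrt _) => z e; field: e.
have l0 : l != 0.
  by apply/eqP => e; move/eqP: hl; rewrite e expr0n /= mulr0 subrr add0r oner_eq0.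
pose W1 t := X (t + tau) - l^-1 * X t; pose W2 t := Y (t + tau) - l^-1 * Y t.
have hW : linear_solution a b W1 W2 by exact: linear_solutionB XYs XY.
have el : tr = l + l^-1.
  by apply: (mulIf l0); rewrite mulrDl mulVf //; have := hl; rewrite expr2; lra.
have W1s : W1 (0 + tau) = l * W1 0.
  by rewrite /W1 (cayley 0).1 el; move: (X 0) (X (0 + tau)) => x y; field.
have W2s : W2 (0 + tau) = l * W2 0.
  by rewrite /W2 (cayley 0).2 el; move: (Y 0) (Y (0 + tau)) => x y; field.
have [x hx] := half_angle_exists (W1 0) (W2 0).
have hs := flow_solution ca cb pa pb x.
have hp := polar_linear_solution ca hs.
have := wronskian_cst hW hp 0 (0 + tau).
rewrite W1s W2s (amplitude0 ca hs) (flow0 ca cb pa pb) !mul1r hx.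
rewrite add0r -/(poincare a b x); move: (amplitude_gt0 a (flow a b x) tau) => r0.
set r := amplitude _ _ _ in r0 *; set p := poincare a b x => e.
have hp0 : W1 0 * sin (p / 2) - W2 0 * cos (p / 2) = 0.
  by apply: (mulfI (mulf_neq0 l0 (lt0r_neq0 r0))); rewrite mulr0 [RHS]e; ring.
have hsin : sin ((p - x) / 2) = 0.
  rewrite mulrBl sinB.
  have [w0|w0] := eqVneq (W1 0) 0; last first.
    apply: (mulfI w0); rewrite mulr0.
    have -> : W1 0 * (sin (p / 2) * cos (x / 2) - cos (p / 2) * sin (x / 2)) =
      cos (x / 2) * (W1 0 * sin (p / 2) - W2 0 * cos (p / 2)) -
      cos (p / 2) * (W1 0 * sin (x / 2) - W2 0 * cos (x / 2)) by ring.
    by rewrite hp0 hx !mulr0 subrr.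
  have w2 : W2 0 != 0.
    apply/eqP => w2; move/eqP: q_neq0; apply.
    have e0 : X 0 * W2 0 - Y 0 * W1 0 = 0 by rewrite w0 w2 !mulr0 subrr.
    by rewrite -[RHS]e0 /W1 /W2; ring.
  apply: (mulfI w2); rewrite mulr0.
  have -> : W2 0 * (sin (p / 2) * cos (x / 2) - cos (p / 2) * sin (x / 2)) =
    sin (x / 2) * (W1 0 * sin (p / 2) - W2 0 * cos (p / 2)) -
    sin (p / 2) * (W1 0 * sin (x / 2) - W2 0 * cos (x / 2)) by ring.
  by rewrite hp0 hx !mulr0 subrr.
have [k hk] := sin_half_eq0 hsin.
have := no_fixed_point k x; rewrite -/p -hk.
by rewrite addrC subrK eqxx.
Qed.

(** Let v be a solution of the linear system, v+ = v (. + 2 pi), and q the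
    determinant of (v, v+), which is constant.  Cayley-Hamilton gives
    v++ = tr v+ - v.  A real eigenvector of the monodromy would yield a fixed
    point of P modulo 2 pi, so |tr| < 2, and then the 2 pi-periodic form
    v^2 - tr v v+ + (v+)^2 is positive definite in each coordinate. *)
Lemma elliptic_bounded : exists N, forall t,
  X t ^+ 2 + X (t + tau) ^+ 2 + Y t ^+ 2 + Y (t + tau) ^+ 2 <= N.
Proof.
have key (Z : R -> R) : continuous Z ->
    (forall t, Z (t + tau + tau) = tr * Z (t + tau) - Z t) ->
    exists N, forall t, Z t ^+ 2 + Z (t + tau) ^+ 2 <= N.
  move=> cZ hZ.
  have cZs : continuous (fun t => Z (t + tau)).
    move=> t; apply: (@continuous_comp _ _ _ (fun t => t + tau) Z); last exact: cZ.
    by apply: cvgD; [exact: cvg_id|exact: cvg_cst].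
  have [||M hM] := @periodic_bounded R (fun t => Z t ^+ 2 - tr * (Z t * Z (t + tau)) + Z (t + tau) ^+ 2).
  - move=> t; apply: cvgD; last by apply: cvgM; exact: cZs.
    apply: cvgB; first by apply: cvgM; exact: cZ.
    by apply: cvgMl_tmp; apply: cvgM; [exact: cZ|exact: cZs].
  - by move=> t; rewrite hZ; ring.
  exists (8 * M / (4 - tr ^+ 2)) => t.
  have h4 : 0 < 4 - tr ^+ 2 by rewrite subr_gt0.
  rewrite ler_pdivlMr //.
  have := hM t; rewrite ler_norml => /andP[_].
  move: (Z t) (Z (t + tau)) => x y hxy.
  have : 0 <= (2 * x - tr * y) ^+ 2 + (2 * y - tr * x) ^+ 2.
    by rewrite addr_ge0 ?sqr_ge0.
  by rewrite !expr2; lra.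
have [N1 h1] := key X (hderiv_continuous XY.1) (fun t => (cayley t).1).
have [N2 h2] := key Y (hderiv_continuous XY.2) (fun t => (cayley t).2).
by exists (N1 + N2) => t; rewrite -addrA lerD.
Qed.

End Elliptic.

(** * Strict monotonicity of a rotation number that is not an integer *)

Lemma sum_sqr_det_le (R : realType) (x y xs ys u v : R) :
  (x * v - y * u) ^+ 2 + (xs * v - ys * u) ^+ 2 <=
  (x ^+ 2 + xs ^+ 2 + y ^+ 2 + ys ^+ 2) * (u ^+ 2 + v ^+ 2).
Proof.
rewrite -subr_ge0.
have -> : (x ^+ 2 + xs ^+ 2 + y ^+ 2 + ys ^+ 2) * (u ^+ 2 + v ^+ 2) -
  ((x * v - y * u) ^+ 2 + (xs * v - ys * u) ^+ 2) =
  (x * u + y * v) ^+ 2 + (xs * u + ys * v) ^+ 2 by ring.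
by rewrite addr_ge0 ?sqr_ge0.
Qed.

(** The identity that makes the quotient of two determinants monotone in
    [gap_grows]: its right-hand side is a constant times a square norm. *)
Lemma det_exchange (R : comPzRingType) (x y xs ys u v : R) :
  (x * v - y * u) * (xs * u + ys * v) - (xs * v - ys * u) * (x * u + y * v) =
  (x * ys - y * xs) * (u ^+ 2 + v ^+ 2).
Proof. by ring. Qed.

Section Strict.
Context {R : realType}.
Variables (a b e : R -> R) (e0 : R).
Hypotheses (ca : continuous a) (cb : continuous b) (ce : continuous e).
Hypotheses (pa : periodic a tau) (pb : periodic b tau) (pe : periodic e tau).
Hypotheses (e0_gt0 : 0 < e0) (e0_le : forall t, e0 <= e t).
Local Notation f := (phase_field a b).
Local Notation b' := (fun t => b t + e t).
Local Notation f' := (phase_field a b').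

Let cb' : continuous b'. Proof. by move=> t; apply: cvgD; [exact: cb|exact: ce]. Qed.
Let pb' : periodic b' tau. Proof. by move=> t; rewrite pb pe. Qed.

(** Since b' = b + e with e > 0, a solution for b' can cross a translate of a
    solution for b only upwards. *)
Lemma gap_level th th' (k : int) s : is_solution f th -> is_solution f' th' ->
  tau * k%:~R <= th' s - th s ->
  forall t, s <= t -> tau * k%:~R <= th' t - th t /\
    (s < t -> tau * k%:~R < th' t - th t).
Proof.
move=> hs hs' hk t st; have [K aK] := periodic_bounded ca pa.
pose d r := th' (r + s) - th (r + s) - tau * k%:~R.
have dd : hderiv d (fun r => f' (th' (r + s)) (r + s) - f (th (r + s)) (r + s)).
  apply: hderiv_eq (hderivB (hderiv_shift s (hderivB (solution_hderiv hs')
    (solution_hderiv hs))) (hderivC _)) _ => r.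
  by rewrite subr0.
have hd r : 0 <= r -> e0 - K * `|d r| <= f' (th' (r + s)) (r + s) - f (th (r + s)) (r + s).
  move=> _; have := field_lipschitz b (th' (r + s)) (th (r + s) + tau * k%:~R) (r + s) aK.
  have -> : th' (r + s) - (th (r + s) + tau * k%:~R) = d r by rewrite /d; ring.
  rewrite /phase_field (periodicz (@cosD2pi R)) ler_norml => /andP[h _].
  by have := e0_le (r + s); lra.
have d0 : 0 <= d 0 by rewrite /d add0r subr_ge0.
have ts : 0 <= t - s by rewrite subr_ge0.
have [h1 h2] := comparison dd (bound_ge0 aK) (ltW e0_gt0) hd d0 ts.
rewrite /d subrK subr_ge0 in h1; split=> // lt_st.
have : 0 < d (t - s) * expR (K * (t - s)).
  by apply: lt_le_trans h2; rewrite ltr_wpDl // mulr_gt0 // subr_gt0.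
by rewrite pmulr_lgt0 ?expR_gt0 // /d subrK subr_gt0.
Qed.

Lemma poincare_strict_mono x : poincare a b x < poincare a b' x.
Proof.
have hs := flow_solution ca cb pa pb x.
have hs' := flow_solution ca cb' pa pb' x.
have h : tau * 0%:~R <= flow a b' x 0 - flow a b x 0.
  by rewrite (flow0 ca cb' pa pb') (flow0 ca cb pa pb) subrr mulr0.
have [_ /(_ (tau_gt0 (R := R)))] := gap_level hs hs' h (ltW tau_gt0).
by rewrite mulr0 subr_gt0.
Qed.

Section NoFixedPoint.
Hypothesis no_fixed_point :
  forall (k : int) x, poincare a b x != x + tau * k%:~R.

(** Let v, v' be the vectors of th, th' and v+ = v (. + 2 pi).  As long as th' - th
    stays between two multiples of 2 pi, the determinant of (v, v') is not
    zero, and the quotient det (v+, v') / det (v, v') has a derivative of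
    constant sign.  By [elliptic_bounded] its arctangent even moves at a rate
    bounded below, so this cannot last longer than a fixed time T0. *)
Lemma gap_grows th : is_solution f th -> exists2 T0, 0 < T0 &
  forall th' (k : int) s, is_solution f' th' ->
  tau * k%:~R <= th' s - th s ->
  tau * (k + 1)%:~R <= th' (s + T0) - th (s + T0).
Proof.
move=> hs.
have hv := polar_linear_solution ca hs.
set X := (fun t : R => _ * cos _) in hv; set Y := (fun t : R => _ * sin _) in hv.
have hvs := linear_solution_shift pa pb hv.
have amp := amplitude_gt0 a th.
set q := X 0 * Y (0 + tau) - Y 0 * X (0 + tau).
have q0 : q != 0.
  have -> : q = amplitude a th 0 * amplitude a th (0 + tau) *
      sin ((th (0 + tau) - th 0) / 2).
    by rewrite /q /X /Y mulrBl sinB; ring.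
  apply: mulf_neq0; first by rewrite mulf_neq0 ?gt_eqF.
  apply/eqP => /sin_half_eq0[k hk].
  have := no_fixed_point k (th 0); rewrite -(poincareE ca cb pa pb hs) -hk add0r.
  by rewrite addrC subrK eqxx.
have [N hN] := elliptic_bounded ca cb pa pb no_fixed_point hv q0.
have N0 : 0 < N.
  apply: lt_le_trans (hN 0); rewrite ltr_wpDr ?sqr_ge0 //.
  have -> : X 0 ^+ 2 + X (0 + tau) ^+ 2 + Y 0 ^+ 2 =
    amplitude a th 0 ^+ 2 * (cos (th 0 / 2) ^+ 2 + sin (th 0 / 2) ^+ 2) + X (0 + tau) ^+ 2.
    by rewrite /X /Y; ring.
  by rewrite cos2Dsin2 mulr1 ltr_wpDr ?sqr_ge0 // exprn_gt0.
pose rate := q ^+ 2 * (e0 / 2) / N.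
have rate_gt0 : 0 < rate by rewrite /rate divr_gt0 // mulr_gt0 ?divr_gt0 // exprn_even_gt0.
(* one unit of time leaves the start, where v and v' may be parallel; then
   q * atan (Ds / D), which varies by at most |q| pi, has derivative at least rate *)
exists (1 + (`|q| * pi + 1) / rate).
  by rewrite ltr_wpDr // divr_ge0 ?ltW // ltr_wpDl // mulr_ge0 // pi_ge0.
set T0 := 1 + _ => th' k s hs' hk.
have T01 : 1 <= T0.
  by rewrite lerDl divr_ge0 ?ltW // ltr_wpDl // mulr_ge0 // pi_ge0.
rewrite leNgt; apply/negP => hlt.
(* v and v' are not parallel while the gap stays strictly inside one cell *)
have inside t : s < t <= s + T0 ->
    tau * k%:~R < th' t - th t < tau * (k + 1)%:~R.
  move=> /andP[st tT]; apply/andP; split.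
    by have [_] := gap_level hs hs' hk (ltW st); apply.
  rewrite ltNge; apply/negP => h.
  by have [] := gap_level hs hs' h tT; rewrite leNgt hlt.
have hv' := polar_linear_solution ca hs'.
set X' := (fun t : R => _ * cos _) in hv'; set Y' := (fun t : R => _ * sin _) in hv'.
pose D t := X t * Y' t - Y t * X' t.
pose Ds t := X (t + tau) * Y' t - Y (t + tau) * X' t.
have D0 t : s < t <= s + T0 -> D t != 0.
  move=> /inside; have -> : D t = amplitude a th t * amplitude a th' t *
      sin ((th' t - th t) / 2).
    by rewrite /D /X /Y /X' /Y' mulrBl sinB; ring.
  move=> hin; apply: mulf_neq0; first by rewrite mulf_neq0 ?gt_eqF ?amplitude_gt0.
  apply/eqP => /sin_half_eq0[j hj]; move: hin; rewrite hj.
  by rewrite !(ltr_pM2l tau_gt0) !ltr_int ltzD1 ltNge => /andP[/negbTE->].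
have dD : hderiv D (fun t => e t / 2 * (X t * X' t + Y t * Y' t)).
  apply: hderiv_eq (hderivB (hderivM hv.1 hv'.2) (hderivM hv.2 hv'.1)) _ => t.
  by ring.
have dDs : hderiv Ds (fun t => e t / 2 * (X (t + tau) * X' t + Y (t + tau) * Y' t)).
  apply: hderiv_eq (hderivB (hderivM hvs.1 hv'.2) (hderivM hvs.2 hv'.1)) _ => t.
  by ring.
(* up to the term rate * t, q times the angle whose tangent is the quotient of determinants *)
pose G t := q * atan (Ds t / D t) - rate * t.
pose n2 t := X' t ^+ 2 + Y' t ^+ 2.
have n20 t : 0 < n2 t.
  have -> : n2 t = amplitude a th' t ^+ 2 * (cos (th' t / 2) ^+ 2 + sin (th' t / 2) ^+ 2).
    by rewrite /n2 /X' /Y'; ring.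
  by rewrite cos2Dsin2 mulr1 exprn_gt0 // amplitude_gt0.
have dG t : s < t <= s + T0 ->
    is_derive t (1 : R) G (q ^+ 2 * (e t / 2) * n2 t / (D t ^+ 2 + Ds t ^+ 2) - rate).
  move=> st; have Dt := D0 t st.
  have dq : is_derive t (1 : R) (fun r => Ds r / D r) (e t / 2 * q * n2 t / D t ^+ 2).
    apply: (is_derive_eq (is_derive_div Dt (dDs t) (dD t))).
    have <- : X t * Y (t + tau) - Y t * X (t + tau) = q := wronskian_cst hv hvs t 0.
    congr (_ / _); rewrite mulrCA [X in _ - X]mulrCA -mulrBr -[RHS]mulrA.
    by congr (_ * _); exact: det_exchange.
  have dat : is_derive t (1 : R) (fun r => atan (Ds r / D r)) _ :=
    @is_derive1_comp _ _ (fun r => Ds r / D r) _ _ _ (is_derive1_atan _) dq.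
  have h : is_derive t (1 : R) G _ :=
    is_deriveB (is_deriveZ q dat) (is_deriveZ rate (is_derive_id t (1 : R))).
  apply: (is_derive_eq h); rewrite /GRing.scale /= mulr1; congr (_ - _).
  move: (D t) (Ds t) Dt (q) (n2 t) (e t) => x y x0 z w g.
  by field; rewrite x0 andbT gt_eqF // ltr_pwDl ?sqr_ge0 // exprn_even_gt0.
have sT : s + 1 <= s + T0 by rewrite lerD2l.
have st1 t : s + 1 <= t <= s + T0 -> s < t <= s + T0.
  by move=> /andP[h ->]; rewrite andbT; lra.
have : G (s + 1) <= G (s + T0).
  apply: (@is_derive_ge0_le R G (fun t => q ^+ 2 * (e t / 2) * n2 t /
    (D t ^+ 2 + Ds t ^+ 2) - rate) _ _ sT).
  - apply: continuous_in_subspaceT => t /[!inE]/= /[!in_itv]/= /st1/dG.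
    exact: hderiv_at_continuous.
  - by move=> t ht; apply: dG; lra.
  - move=> t ht; have st : s < t <= s + T0 by lra.
    rewrite subr_ge0 /rate.
    have DD : 0 < D t ^+ 2 + Ds t ^+ 2.
      by rewrite ltr_pwDl ?sqr_ge0 // exprn_even_gt0 // D0.
    rewrite ler_pdivlMr // mulrAC ler_pdivrMr //.
    have cs : D t ^+ 2 + Ds t ^+ 2 <= N * n2 t.
      apply: (@le_trans _ _ ((X t ^+ 2 + X (t + tau) ^+ 2 + Y t ^+ 2 + Y (t + tau) ^+ 2) * n2 t)).
        exact: sum_sqr_det_le.
      by rewrite ler_pM2r.
    apply: (@le_trans _ _ (q ^+ 2 * (e0 / 2) * (N * n2 t))).
      by rewrite ler_wpM2l // mulr_ge0 ?sqr_ge0 // divr_ge0 // ltW.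
    rewrite -[leRHS]mulrA [n2 t * N]mulrC ler_wpM2r //; first by rewrite mulr_ge0 ?ltW.
    by rewrite ler_wpM2l ?sqr_ge0 // ler_wpM2r // e0_le.
have at_bound z : `|q * atan z| <= `|q| * (pi / 2).
  by rewrite normrM ler_wpM2l // ler_norml !ltW ?atan_gtNpi2 ?atan_ltpi2.
have := at_bound (Ds (s + 1) / D (s + 1)); have := at_bound (Ds (s + T0) / D (s + T0)).
have kT : rate * (T0 - 1) = `|q| * pi + 1.
  by rewrite /T0 addrAC subrr add0r mulrC divfK ?gt_eqF.
rewrite /G !ler_norml; lra.
Qed.

Lemma rotation_number_strict : rotation_number f < rotation_number f'.
Proof.
have hs := flow_solution ca cb pa pb 0.
have hs' := flow_solution ca cb' pa pb' 0.
have [c hc] := rotation_numberP ca cb pa pb hs.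
have [c' hc'] := rotation_numberP ca cb' pa pb' hs'.
have [T0 T00 hT] := gap_grows hs.
have hn (n : nat) : tau * n%:R <= flow a b' 0 (T0 * n%:R) - flow a b 0 (T0 * n%:R).
  elim: n => [|n ih].
    by rewrite mulr0 mulr0 (flow0 ca cb' pa pb') (flow0 ca cb pa pb) subrr.
  have := hT _ n%:Z _ hs' ih.
  by rewrite -[n.+1%:R]natr1 intrD !mulrDr !mulr1.
suff : rotation_number f - rotation_number f' + tau / T0 <= 0.
  by have : 0 < tau / T0 :> R by [rewrite divr_gt0 ?tau_gt0]; lra.
rewrite -(pmulr_rle0 _ T00); apply: (@linear_le_bounded _ _ (c + c')) => n.
have Tn : 0 <= T0 * n%:R by rewrite mulr_ge0 // ltW.
have := hc _ Tn; have := hc' _ Tn; have := hn n; rewrite !ler_norml.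
have -> : T0 * (rotation_number f - rotation_number f' + tau / T0) * n%:R =
    rotation_number f * (T0 * n%:R) - rotation_number f' * (T0 * n%:R) + tau * n%:R.
  by field; rewrite gt_eqF.
lra.
Qed.

End NoFixedPoint.
End Strict.

(** * Complex-valued functions of a real variable *)

Section Integral.
Context {R : realType}.
Implicit Types (f g : R -> R).

Lemma prim_eq F f : continuous f -> hderiv F f -> prim f tau = F tau - F 0.
Proof.
move=> cf dF; have [p0 dp] := primP cf.
have dF' : hderiv (fun t => F t - F 0) f.
  by apply: hderiv_eq (hderivB dF (hderivC _)) _ => t; rewrite subr0.
by apply: (hderiv_unique (a := 0) tau dp dF'); rewrite p0 subrr.
Qed.

Lemma prim_le f g : continuous f -> continuous g ->
  (forall t, 0 <= t <= tau -> f t <= g t) -> prim f tau <= prim g tau.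
Proof.
move=> /primP[f0 df] /primP[g0 dg] fg.
by have := hderiv_le df dg (ltW tau_gt0) fg; rewrite f0 g0 !subr0.
Qed.

Lemma primD f g : continuous f -> continuous g ->
  prim (fun t => f t + g t) tau = prim f tau + prim g tau.
Proof.
move=> cf cg; have [f0 df] := primP cf; have [g0 dg] := primP cg.
rewrite (prim_eq _ (hderivD df dg)) ?f0 ?g0 ?addr0 ?subr0 //.
by move=> t; apply: cvgD; [exact: cf|exact: cg].
Qed.

Lemma primZ c f : continuous f -> prim (fun t => c * f t) tau = c * prim f tau.
Proof.
move=> cf; have [f0 df] := primP cf.
rewrite (prim_eq _ (hderivZ c df)) ?f0 ?mulr0 ?subr0 //.
by move=> t; apply: cvgMl_tmp; exact: cf.
Qed.

Lemma prim_norm_le f M : continuous f -> (forall t, 0 <= t <= tau -> `|f t| <= M) ->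
  `|prim f tau| <= M * tau.
Proof.
move=> cf h; have [f0 df] := primP cf.
have dM := hderivZ M (@hderiv_id R).
have h1 := hderiv_le df dM (ltW tau_gt0); have h2 := hderiv_le (hderivN dM) df (ltW tau_gt0).
have {}h1 : prim f tau - prim f 0 <= M * tau - M * 0.
  by apply: h1 => t /h; rewrite mulr1; apply: le_trans (ler_norm _).
have {}h2 : - (M * tau) - - (M * 0) <= prim f tau - prim f 0.
  by apply: h2 => t /h; rewrite mulr1 ler_norml => /andP[].
by rewrite f0 in h1 h2; rewrite ler_norml; lra.
Qed.

End Integral.

Local Notation im := (Complex 0 1).

Section ComplexCalculus.
Import Normc.
Local Open Scope complex_scope.
Context {R : realType}.
Local Notation C := R[i].
Implicit Types (F G : R -> C) (z w : C).

Lemma complex_ReD z w : complex.Re (z + w) = complex.Re z + complex.Re w.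
Proof. by case: z w => [? ?] []. Qed.
Lemma complex_ImD z w : complex.Im (z + w) = complex.Im z + complex.Im w.
Proof. by case: z w => [? ?] []. Qed.
Lemma complex_ReM z w : complex.Re (z * w) =
  complex.Re z * complex.Re w - complex.Im z * complex.Im w.
Proof. by case: z w => [? ?] []. Qed.
Lemma complex_ImM z w : complex.Im (z * w) =
  complex.Re z * complex.Im w + complex.Im z * complex.Re w.
Proof. by case: z w => [? ?] []. Qed.
Lemma complex_eq z w : complex.Re z = complex.Re w -> complex.Im z = complex.Im w -> z = w.
Proof. by move: z w => [? ?] [? ?] /= -> ->. Qed.

Definition cderiv F G := hderiv (fun t => complex.Re (F t)) (fun t => complex.Re (G t)) /\
  hderiv (fun t => complex.Im (F t)) (fun t => complex.Im (G t)).

Definition ccontinuous F := continuous (fun t => complex.Re (F t)) /\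
  continuous (fun t => complex.Im (F t)).

Definition cint F : C := prim (fun t => complex.Re (F t)) tau +i* prim (fun t => complex.Im (F t)) tau.

Lemma cderiv_eq F G G' : cderiv F G -> (forall t, G t = G' t) -> cderiv F G'.
Proof. by move=> dF /funext <-. Qed.

Lemma cderivD F F' G G' : cderiv F F' -> cderiv G G' ->
  cderiv (fun t => F t + G t) (fun t => F' t + G' t).
Proof.
move=> [d1 d2] [d3 d4]; split.
- apply: hderiv_congr (hderivD d1 d3) _ _ => t; by rewrite complex_ReD.
- apply: hderiv_congr (hderivD d2 d4) _ _ => t; by rewrite complex_ImD.
Qed.

Lemma cderivM F F' G G' : cderiv F F' -> cderiv G G' ->
  cderiv (fun t => F t * G t) (fun t => F t * G' t + G t * F' t).
Proof.
move=> [d1 d2] [d3 d4]; split.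
- apply: hderiv_congr (hderivB (hderivM d1 d3) (hderivM d2 d4)) _ _ => t.
    by rewrite complex_ReM.
  by rewrite complex_ReD !complex_ReM; ring.
- apply: hderiv_congr (hderivD (hderivM d1 d4) (hderivM d2 d3)) _ _ => t.
    by rewrite complex_ImM.
  by rewrite complex_ImD !complex_ImM; ring.
Qed.

Lemma cderivC z : cderiv (fun=> z) (fun=> 0).
Proof. by split; exact: hderivC. Qed.

Lemma cderivZ z F F' : cderiv F F' -> cderiv (fun t => z * F t) (fun t => z * F' t).
Proof.
by move=> d; apply: cderiv_eq (cderivM (cderivC z) d) _ => t; rewrite mulr0 addr0.
Qed.

Lemma cderiv_real (f f' : R -> R) : hderiv f f' ->
  cderiv (fun t => (f t)%:C) (fun t => (f' t)%:C).
Proof. by split => //; exact: hderivC. Qed.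

Definition cis (x : R) : C := cos x +i* sin x.

Lemma cisD x y : cis (x + y) = cis x * cis y.
Proof. by apply: complex_eq; rewrite ?complex_ReM ?complex_ImM /= ?cosD ?sinD; ring. Qed.

Lemma cis0 : cis 0 = 1.
Proof. by rewrite /cis cos0 sin0. Qed.

Lemma cisNK x : cis (- x) * cis x = 1.
Proof. by rewrite -cisD addNr cis0. Qed.

Lemma cisDtau (k : int) x : cis (x + tau * k%:~R) = cis x.
Proof. by rewrite /cis (periodicz (@cosD2pi R)) (periodicz (@sinD2pi R)). Qed.

Lemma cderiv_cis (f f' : R -> R) : hderiv f f' ->
  cderiv (fun t => cis (f t)) (fun t => im * (f' t)%:C * cis (f t)).
Proof.
move=> df; split.
- apply: hderiv_congr (hderiv_cos df) _ _ => t; [by []|rewrite !complex_ReM /=; ring].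
- apply: hderiv_congr (hderiv_sin df) _ _ => t; [by []|rewrite !complex_ImM !complex_ReM /=; ring].
Qed.

Lemma cderiv_continuous F G : cderiv F G -> ccontinuous F.
Proof. by case=> /hderiv_continuous ? /hderiv_continuous ?. Qed.

Lemma ccontinuousD F G : ccontinuous F -> ccontinuous G -> ccontinuous (fun t => F t + G t).
Proof.
move=> [c1 c2] [c3 c4]; split.
- rewrite (_ : (fun t => _) = (fun t => complex.Re (F t) + complex.Re (G t))); last first.
    by apply/funext => t; rewrite complex_ReD.
  by move=> t; apply: cvgD; [exact: c1|exact: c3].
- rewrite (_ : (fun t => _) = (fun t => complex.Im (F t) + complex.Im (G t))); last first.
    by apply/funext => t; rewrite complex_ImD.
  by move=> t; apply: cvgD; [exact: c2|exact: c4].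
Qed.

Lemma ccontinuousM F G : ccontinuous F -> ccontinuous G -> ccontinuous (fun t => F t * G t).
Proof.
move=> [c1 c2] [c3 c4]; split.
- rewrite (_ : (fun t => _) = (fun t => complex.Re (F t) * complex.Re (G t) -
    complex.Im (F t) * complex.Im (G t))); last by apply/funext => t; rewrite complex_ReM.
  by move=> t; apply: cvgB; apply: cvgM; [exact: c1|exact: c3|exact: c2|exact: c4].
- rewrite (_ : (fun t => _) = (fun t => complex.Re (F t) * complex.Im (G t) +
    complex.Im (F t) * complex.Re (G t))); last by apply/funext => t; rewrite complex_ImM.
  by move=> t; apply: cvgD; apply: cvgM; [exact: c1|exact: c4|exact: c2|exact: c3].
Qed.

Lemma ccontinuous_cst z : ccontinuous (fun=> z).
Proof. exact: cderiv_continuous (cderivC z). Qed.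

Lemma ccontinuous_real (f : R -> R) : continuous f -> ccontinuous (fun t => (f t)%:C).
Proof. by move=> cf; split => //; exact: cst_continuous. Qed.

Lemma cintD F G : ccontinuous F -> ccontinuous G ->
  cint (fun t => F t + G t) = cint F + cint G.
Proof.
move=> [c1 c2] [c3 c4]; apply: complex_eq; rewrite ?complex_ReD ?complex_ImD /=.
- by rewrite -primD //; congr (prim _ _); apply/funext => t; rewrite complex_ReD.
- by rewrite -primD //; congr (prim _ _); apply/funext => t; rewrite complex_ImD.
Qed.

Let continuousZ (f : R -> R) (c : R) : continuous f -> continuous (fun t => c * f t).
Proof. by move=> cf t; apply: cvgMl_tmp; exact: cf. Qed.

Lemma cintZ z F : ccontinuous F -> cint (fun t => z * F t) = z * cint F.
Proof.
move=> [c1 c2]; apply: complex_eq; rewrite ?complex_ReM ?complex_ImM /=.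
- rewrite -!primZ // -[- prim _ _]mulN1r -primZ; last exact: continuousZ.
  rewrite -primD; [|exact: continuousZ|by do 2!apply: continuousZ].
  by congr (prim _ _); apply/funext => t; rewrite complex_ReM; ring.
- rewrite -!primZ // -primD; [|exact: continuousZ|exact: continuousZ].
  by congr (prim _ _); apply/funext => t; rewrite complex_ImM.
Qed.

Lemma cint_cderiv F G : ccontinuous G -> cderiv F G -> cint G = F tau - F 0.
Proof.
move=> [c1 c2] [d1 d2]; rewrite /cint (prim_eq c1 d1) (prim_eq c2 d2).
by apply: complex_eq => /=; case: (F tau); case: (F 0).
Qed.

Lemma normc_cis x : normc (cis x) = 1.
Proof. by rewrite /cis /normc cos2Dsin2 sqrtr1. Qed.

Lemma normc_Re z : `|complex.Re z| <= normc z.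
Proof.
case: z => x y /=; rewrite -sqrtr_sqr ler_wsqrtr // lerDl; exact: sqr_ge0.
Qed.

Lemma normc_Im z : `|complex.Im z| <= normc z.
Proof.
case: z => x y /=; rewrite -sqrtr_sqr ler_wsqrtr // lerDr; exact: sqr_ge0.
Qed.

Lemma normc_le_ReIm z : normc z <= `|complex.Re z| + `|complex.Im z|.
Proof.
case: z => x y /=; rewrite -[leRHS]ger0_norm ?addr_ge0 // -sqrtr_sqr ler_wsqrtr //.
rewrite sqrrD !real_normK ?num_real // addrAC lerDl.
by rewrite mulrn_wge0 // mulr_ge0.
Qed.

Lemma normc_ge0 z : 0 <= normc z.
Proof. by apply: le_trans (normr_ge0 _) (normc_Re z). Qed.

Lemma cint_norm_le F M : ccontinuous F ->
  (forall t, 0 <= t <= tau -> normc (F t) <= M) -> normc (cint F) <= 2 * M * tau.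
Proof.
move=> [c1 c2] h; apply: le_trans (normc_le_ReIm _) _ => /=.
rewrite -mulrA mulr_natl mulr2n; apply: lerD; apply: prim_norm_le => // t /h.
- exact: le_trans (normc_Re _).
- exact: le_trans (normc_Im _).
Qed.

Lemma ccontinuous_bounded F : ccontinuous F ->
  exists M, forall t, 0 <= t <= tau -> normc (F t) <= M.
Proof.
move=> [c1 c2].
have ex (f : R -> R) : continuous f -> exists M, forall t, 0 <= t <= tau -> `|f t| <= M.
  move=> cf; have [|c _ hc] := @EVT_max R (fun t => `|f t|) 0 tau (ltW tau_gt0).
    apply: continuous_subspaceT => t; apply: continuous_comp; first exact: cf.
    exact: norm_continuous.
  by exists `|f c| => t ht; apply: hc; rewrite in_itv.
have [M1 h1] := ex _ c1; have [M2 h2] := ex _ c2.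
exists (M1 + M2) => t ht; apply: le_trans (normc_le_ReIm _) _.
by apply: lerD; [exact: h1|exact: h2].
Qed.

End ComplexCalculus.

(** * Fourier coefficients with respect to a change of angle *)

(** Derivative of sin u (1 + cos u)^N with respect to u, where c = cos u and
    s = sin u; integrating it relates the masses of consecutive kernels. *)
Lemma kernel_recurrence (R : comRingType) N (c s d : R) : s ^+ 2 = 1 - c ^+ 2 ->
  s * (N%:R * (1 + c) ^+ N.-1 * (0 + - s * d)) + (1 + c) ^+ N * (c * d) =
  N.+1%:R * ((1 + c) ^+ N.+1 * d) + - (2 * N%:R + 1) * ((1 + c) ^+ N * d).
Proof.
move=> e; case: N => [|N] /=; first by rewrite expr0 expr1; ring.
rewrite !exprS -[N.+2%:R]natr1 -[N.+1%:R]natr1; move: ((1 + c) ^+ N) => k.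
have -> : s * ((N%:R + 1) * k * (0 + - s * d)) = - ((N%:R + 1) * k * d * s ^+ 2) by ring.
by rewrite e; ring.
Qed.

Section FourierCoefficients.
Import Normc.
Local Open Scope complex_scope.
Context {R : realType}.
Local Notation C := R[i].
Variables (u du : R -> R) (mu : R).
Hypotheses (u_deriv : hderiv u du) (cdu : continuous du).
Hypotheses (du_gt0 : forall t, 0 < du t) (u0 : u 0 = 0) (cis_u : cis (u tau) = 1).

(** The frequencies n + mu are those of functions that are multiplied by
    cis (mu * u tau) over a period; the weight du in [fcoef] makes u the variable
    of integration. *)
Definition wave (n : int) (t : R) : C := cis (- ((n%:~R + mu) * u t)).
Definition fcoef (F : R -> C) (n : int) : C :=
  cint (fun t => F t * (wave n t * (du t)%:C)).
Definition quasiperiodic (F : R -> C) := F tau = cis (mu * u tau) * F 0.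

Let wave_deriv n : cderiv (wave n)
  (fun t => im * (- ((n%:~R + mu) * du t))%:C * wave n t).
Proof. exact: cderiv_cis (hderivN (hderivZ _ u_deriv)). Qed.

Let cwave n : ccontinuous (wave n).
Proof. exact: cderiv_continuous (wave_deriv n). Qed.

Let cweight n : ccontinuous (fun t => wave n t * (du t)%:C).
Proof. exact: ccontinuousM (cwave n) (ccontinuous_real cdu). Qed.

Let cprod F n : ccontinuous F -> ccontinuous (fun t => F t * (wave n t * (du t)%:C)).
Proof. by move=> cF; exact: ccontinuousM cF (cweight n). Qed.

Let wave0 n : wave n 0 = 1.
Proof. by rewrite /wave u0 mulr0 oppr0 cis0. Qed.

Let cis_u_int (n : int) : cis (n%:~R * u tau) = 1.
Proof.
have nat_case (k : nat) : cis (k%:R * u tau) = 1.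
  elim: k => [|k ih]; first by rewrite mul0r cis0.
  by rewrite -natr1 mulrDl cisD ih mul1r mul1r.
case: n => k; first exact: nat_case.
rewrite NegzE mulrNz mulNr; have := cisNK (k.+1%:R * u tau).
by rewrite nat_case mulr1.
Qed.

Let wave_tau n : wave n tau * cis (mu * u tau) = 1.
Proof.
rewrite /wave mulrDl opprD cisD -mulrA cisNK mulr1.
by have := cisNK (n%:~R * u tau); rewrite cis_u_int mulr1.
Qed.

Lemma fcoefD F G n : ccontinuous F -> ccontinuous G ->
  fcoef (fun t => F t + G t) n = fcoef F n + fcoef G n.
Proof.
move=> cF cG; rewrite /fcoef -cintD; try exact: cprod.
by congr cint; apply/funext => t; rewrite mulrDl.
Qed.

Lemma fcoefZ z F n : ccontinuous F -> fcoef (fun t => z * F t) n = z * fcoef F n.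
Proof.
move=> cF; rewrite /fcoef -cintZ; last exact: cprod.
by congr cint; apply/funext => t; rewrite -mulrA.
Qed.

Lemma fcoef_shiftr F n : fcoef (fun t => cis (u t) * F t) n = fcoef F (n - 1).
Proof.
congr cint; apply/funext => t.
rewrite mulrA [cis _ * _]mulrC -!mulrA; congr (_ * _); rewrite mulrA; congr (_ * _).
rewrite /wave -cisD; congr cis; rewrite intrD; ring.
Qed.

Lemma fcoef_shiftl F n : fcoef (fun t => cis (- u t) * F t) n = fcoef F (n + 1).
Proof.
congr cint; apply/funext => t.
rewrite mulrA [cis _ * _]mulrC -!mulrA; congr (_ * _); rewrite mulrA; congr (_ * _).
rewrite /wave -cisD; congr cis; rewrite intrD; ring.
Qed.

(** Integration by parts; the boundary terms cancel because F times the wave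
    takes the same value at 0 and at 2 pi. *)
Lemma fcoef_deriv F G n : cderiv F (fun t => (du t)%:C * G t) -> ccontinuous G ->
  quasiperiodic F -> fcoef G n = im * (n%:~R + mu)%:C * fcoef F n.
Proof.
move=> dF cG qF.
have cF := cderiv_continuous dF.
have d := cderivM dF (wave_deriv n).
have e : cint (fun t => F t * (im * (- ((n%:~R + mu) * du t))%:C * wave n t) +
    wave n t * ((du t)%:C * G t)) = 0.
  rewrite (cint_cderiv _ d).
    by rewrite qF wave0 mulr1 mulrAC [cis _ * _]mulrC wave_tau mul1r subrr.
  apply: ccontinuousD.
    apply: (ccontinuousM cF); apply: ccontinuousM (cwave n).
    apply: ccontinuousM; first exact: ccontinuous_cst.
    apply: ccontinuous_real => t; apply: cvgN; apply: cvgMl_tmp; exact: cdu.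
  exact: ccontinuousM (cwave n) (ccontinuousM (ccontinuous_real cdu) cG).
have e2 : (fun t => F t * (im * (- ((n%:~R + mu) * du t))%:C * wave n t) +
    wave n t * ((du t)%:C * G t)) = (fun t => G t * (wave n t * (du t)%:C) +
    (- (im * (n%:~R + mu)%:C)) * (F t * (wave n t * (du t)%:C))).
  by apply/funext => t; rewrite rmorphN rmorphM /=; ring.
rewrite e2 cintD ?cintZ in e; try exact: cprod.
- by move: e => /eqP; rewrite mulNr subr_eq0 => /eqP.
- exact: ccontinuousM (ccontinuous_cst _) (cprod n cF).
Qed.

Lemma fcoef_bounded F : ccontinuous F -> exists M, forall n, normc (fcoef F n) <= M.
Proof.
move=> cF.
have [M hM] := @ccontinuous_bounded R (fun t => F t * (du t)%:C)
  (ccontinuousM cF (ccontinuous_real cdu)).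
exists (2 * M * tau) => n; apply: cint_norm_le; first exact: cprod.
move=> t /hM; rewrite !normcM mulrCA /wave normc_cis mul1r //.
Qed.

Section Uniqueness.
Hypothesis cos_u_le : forall t, 0 <= t <= tau -> cos (u t) <= cos t.

Let ker N t := (1 + cos (u t)) ^+ N.
Let dker N := hderivX N (hderivD (hderivC (1 : R)) (hderiv_cos u_deriv)).
Let cker N : continuous (fun t => ker N t * du t).
Proof.
move=> t; apply: cvgM; last exact: cdu.
exact: hderiv_continuous (dker N) t.
Qed.
Let J N := prim (fun t => ker N t * du t) tau.

Let J_rec N : N.+1%:R * J N.+1 = (2 * N%:R + 1) * J N.
Proof.
have d := hderivM (hderiv_sin u_deriv) (dker N).
pose g t := N.+1%:R * (ker N.+1 t * du t) + - (2 * N%:R + 1) * (ker N t * du t).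
have cg : continuous g.
  by move=> t; apply: cvgD; apply: cvgMl_tmp; exact: cker.
have dg : hderiv (fun t => sin (u t) * (1 + cos (u t)) ^+ N) g.
  apply: hderiv_eq d _ => t; rewrite /g /ker.
  exact: kernel_recurrence (sin2cos2 _).
have := prim_eq cg dg.
have sL : sin (u tau) = 0 by have := congr1 (fun z => complex.Im z) cis_u.
rewrite u0 sin0 sL !mul0r subrr /g primD; try by move=> t; apply: cvgMl_tmp; exact: cker.
rewrite !primZ; try exact: cker.
by rewrite mulNr => /eqP; rewrite subr_eq0 => /eqP.
Qed.

Let J_gt0 N : 0 < J N.
Proof.
elim: N => [|N ih].
  have -> : J 0 = u tau - u 0.
    rewrite /J -(prim_eq cdu u_deriv); congr prim; apply/funext => t.
    by rewrite /ker expr0 mul1r.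
  rewrite subr_gt0; apply: (hderiv_gt0_lt u_deriv tau_gt0) => t _; exact: du_gt0.
by rewrite -(pmulr_rgt0 _ (ltr0Sn R N)) J_rec mulr_gt0 //.
Qed.

Let real_part_le0 F : ccontinuous F -> quasiperiodic F ->
  (forall n, fcoef F n = 0) -> complex.Re (F 0) <= 0.
Proof.
move=> cF qF hF; rewrite leNgt; apply/negP => F0.
pose eta := complex.Re (F 0) / 2.
have eta0 : 0 < eta by rewrite divr_gt0.
pose h t := complex.Re (F t * wave 0 t).
have ch : continuous h by have [] := ccontinuousM cF (cwave 0).
have h0 : eta < h 0 by rewrite /h wave0 mulr1 /eta; lra.
have htau : eta < h tau.
  by rewrite /h qF mulrAC [cis _ * _]mulrC wave_tau mul1r /eta; lra.
have kerF N n : ccontinuous (fun t => (ker N t)%:C * F t) /\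
    fcoef (fun t => (ker N t)%:C * F t) n = 0.
  split.
    apply: ccontinuousM => //; apply: ccontinuous_real.
    exact: hderiv_continuous (dker N).
  elim: N n => [|N ih] n.
    rewrite -[RHS](hF n); congr fcoef; apply/funext => t.
    by rewrite /ker expr0 mul1r.
  have cN : ccontinuous (fun t => (ker N t)%:C * F t).
    apply: ccontinuousM => //; apply: ccontinuous_real.
    exact: hderiv_continuous (dker N).
  have ccu : ccontinuous (fun t => cis (u t)).
    exact: cderiv_continuous (cderiv_cis u_deriv).
  have ccNu : ccontinuous (fun t => cis (- u t)).
    exact: cderiv_continuous (cderiv_cis (hderivN u_deriv)).
  have -> : (fun t => (ker N.+1 t)%:C * F t) = (fun t => (ker N t)%:C * F t +
     (2^-1 * (cis (u t) * ((ker N t)%:C * F t)) +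
      2^-1 * (cis (- u t) * ((ker N t)%:C * F t)))).
    apply/funext => t; rewrite -mulrDr -mulrDl.
    have -> : cis (u t) + cis (- u t) = 2 * (cos (u t))%:C.
      by rewrite /cis cosN sinN; apply: complex_eq; rewrite ?complex_ReM ?complex_ImM /=; ring.
    by rewrite /ker exprS rmorphM rmorphD rmorph1 /=; field.
  have c1 := ccontinuousM ccu cN; have c2 := ccontinuousM ccNu cN.
  have c3 := ccontinuousM (ccontinuous_cst 2^-1) c1.
  have c4 := ccontinuousM (ccontinuous_cst 2^-1) c2.
  rewrite (fcoefD n cN (ccontinuousD c3 c4)) (fcoefD n c3 c4) (fcoefZ _ n c1) (fcoefZ _ n c2).
  by rewrite fcoef_shiftr fcoef_shiftl !ih mulr0 !addr0.
have zero N : prim (fun t => h t * (ker N t * du t)) tau = 0.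
  have e0 : complex.Re (fcoef (fun t => (ker N t)%:C * F t) 0) = 0.
    by rewrite (kerF N 0).2.
  rewrite -[RHS]e0; apply: (congr1 (fun g => prim g tau)); apply/funext => t.
  have -> : (ker N t)%:C * F t * (wave 0 t * (du t)%:C) =
    (ker N t * du t)%:C * (F t * wave 0 t) by rewrite rmorphM /=; ring.
  by rewrite complex_ReM /= mul0r subr0 mulrC.
(* near t = 0 and t = 2 pi, h exceeds eta; elsewhere 1 - cos t is bounded below *)
have [K K0 hK] : exists2 K, 0 <= K &
    forall t, 0 <= t <= tau -> eta - K * (1 - cos t) <= h t.
  have [r1 r10 hr1] : exists2 r, 0 < r & forall t, `|t| < r -> eta < h t.
    have /cvgrPdist_lt /(_ (h 0 - eta)) := ch 0.
    rewrite subr_gt0 => /(_ h0) [r /= r0 hr]; exists r => // t tr.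
    have := hr t; rewrite /ball /= sub0r normrN => /(_ tr).
    by rewrite ltr_norml; lra.
  have [r2 r20 hr2] : exists2 r, 0 < r & forall t, `|tau - t| < r -> eta < h t.
    have /cvgrPdist_lt /(_ (h tau - eta)) := ch tau.
    rewrite subr_gt0 => /(_ htau) [r /= r0 hr]; exists r => // t tr.
    have := hr t; rewrite /ball /= => /(_ tr).
    by rewrite ltr_norml; lra.
  pose r := Num.min (Num.min r1 r2) pi.
  have r0 : 0 < r by rewrite !lt_min r10 r20 pi_gt0.
  have rpi : r <= pi by rewrite ge_min lexx orbT.
  have [M hM] := ccontinuous_bounded (ccontinuousM cF (cwave 0)).
  have M0 : 0 <= M.
    by apply: le_trans (hM 0 _); [exact: normc_ge0|rewrite lexx ltW // tau_gt0].
  have cr : 0 < 1 - cos r.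
    rewrite subr_gt0 -cos0 ltr_cos // in_itv /= ?lexx ?pi_ge0 //.
    by rewrite (ltW r0) rpi.
  exists ((eta + M) / (1 - cos r)); first by rewrite divr_ge0 ?(ltW cr) // addr_ge0 // ltW.
  move=> t /andP[t0 tT].
  have c1 : 0 <= 1 - cos t by rewrite subr_ge0 cos_le1.
  have [tr|rt] := ltP t r.
    have ht : eta < h t.
      by apply: hr1; rewrite ger0_norm //; apply: lt_le_trans tr _; rewrite !ge_min lexx.
    have : 0 <= (eta + M) / (1 - cos r) * (1 - cos t).
      by rewrite mulr_ge0 // divr_ge0 ?(ltW cr) // addr_ge0 // ltW.
    by lra.
  have [tr|rt'] := ltP (tau - t) r.
    have ht : eta < h t.
      apply: hr2; rewrite ger0_norm ?subr_ge0 //.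
      by apply: lt_le_trans tr _; rewrite !ge_min lexx orbT.
    have : 0 <= (eta + M) / (1 - cos r) * (1 - cos t).
      by rewrite mulr_ge0 // divr_ge0 ?(ltW cr) // addr_ge0 // ltW.
    by lra.
  have ct : cos t <= cos r.
    have [tpi|pit] := leP t pi.
      by rewrite leNgt ltr_cos ?in_itv /= -?leNgt ?t0 ?tpi ?(ltW r0) ?rpi.
    have -> : cos t = cos (tau - t).
      by rewrite -[tau - t]opprB cosN -{1}(subrK tau t) cosD2pi.
    rewrite leNgt ltr_cos ?in_itv /= -?leNgt ?(ltW r0) ?rpi //.
    by rewrite subr_ge0 tT /= lerBlDr mulr2n lerD2l ltW.
  have : eta + M <= (eta + M) / (1 - cos r) * (1 - cos t).
    have c2 : 1 <= (1 - cos r)^-1 * (1 - cos t) by rewrite ler_pdivlMl // mulr1; lra.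
    by rewrite -mulrA ler_peMr // addr_ge0 // ltW.
  have : `|h t| <= M.
    by apply: le_trans (normc_Re _) (hM t _); rewrite t0 tT.
  by rewrite ler_norml; lra.
have lower N : (eta - 2 * K) * J N + K * J N.+1 <= 0.
  rewrite -[leRHS](zero N) /J -!primZ; try exact: cker.
  rewrite -primD; try by move=> t; apply: cvgMl_tmp; exact: cker.
  apply: prim_le.
  - by move=> t; apply: cvgD; apply: cvgMl_tmp; exact: cker.
  - by move=> t; apply: cvgM; [exact: ch|exact: cker].
  move=> t ht; have k0 : 0 <= ker N t * du t.
    apply: mulr_ge0; last exact: ltW; apply: exprn_ge0.
    by have := cos_geN1 (u t); lra.
  have -> : (eta - 2 * K) * (ker N t * du t) + K * (ker N.+1 t * du t) =
    (eta - K * (1 - cos (u t))) * (ker N t * du t).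
    by rewrite /ker exprS; ring.
  apply: ler_wpM2r => //; apply: le_trans (hK t ht).
  by rewrite lerD2l lerN2 ler_wpM2l // lerD2l lerN2 cos_u_le.
(* the least N with K < eta (N + 1) *)
pose N := Num.truncn (K / eta).
have hN : K < eta * N.+1%:R by rewrite mulrC -ltr_pdivrMr // truncnS_gt.
have := lower N; have := J_rec N; have := J_gt0 N; have := J_gt0 N.+1.
move: (J N) (J N.+1) => j j' j'0 j0 hrec hlow.
have : N.+1%:R * ((eta - 2 * K) * j + K * j') <= 0 by rewrite pmulr_rle0.
rewrite mulrDr [N.+1%:R * (K * _)]mulrCA hrec.
have -> : N.+1%:R * ((eta - 2 * K) * j) + K * ((2 * N%:R + 1) * j) =
  (eta * N.+1%:R - K) * j by rewrite -natr1; ring.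
by rewrite pmulr_lle0 // leNgt subr_gt0 hN.
Qed.

(** If the real part of F 0 were positive, F times the wave of frequency mu would
    be bounded below by eta - K (1 - cos u).  Integrated against the kernel
    (1 + cos u)^N of mass J N, this lower bound gives (eta - K / (N + 1)) J N,
    which is positive for large N, while all Fourier coefficients vanish.
    Multiplying F by 1, -1, i and -i gives F 0 = 0. *)
Lemma fourier_uniqueness0 F : ccontinuous F -> quasiperiodic F ->
  (forall n, fcoef F n = 0) -> F 0 = 0.
Proof.
move=> cF qF hF.
have rot z : complex.Re (z * F 0) <= 0.
  apply: (@real_part_le0 (fun t => z * F t)).
  - exact: ccontinuousM (ccontinuous_cst z) cF.
  - by rewrite /quasiperiodic qF mulrCA.
  - by move=> n; rewrite fcoefZ // hF mulr0.
have := rot 1; have := rot (-1); have := rot im; have := rot (- im).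
case: (F 0) => x y; rewrite !complex_ReM /= => h1 h2 h3 h4.
by apply: complex_eq => /=; lra.
Qed.

End Uniqueness.
End FourierCoefficients.

(** * The weight of the family and the true anomaly *)

Section Weights.
Import Normc.
Local Open Scope complex_scope.
Context {R : realType}.
Variables (omega delta : R).
Hypotheses (omega_gt0 : 0 < omega) (delta_itv : 0 < delta < 1).

Definition rsj_weight (t : R) : R := (omega * (1 - delta * cos t))^-1.

Let m (t : R) := 1 - delta * cos t.

Lemma one_minus_delta_cos_gt0 t : 0 < 1 - delta * cos t.
Proof.
case/andP: delta_itv => d0 d1; rewrite subr_gt0.
apply: le_lt_trans d1; rewrite -[leRHS]mulr1 ler_wpM2l ?cos_le1 //; exact: ltW.
Qed.

Lemma rsj_weight_gt0 t : 0 < rsj_weight t.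
Proof. by rewrite invr_gt0 mulr_gt0 // one_minus_delta_cos_gt0. Qed.

Let m_neq0 t : m t != 0.
Proof. by rewrite gt_eqF // one_minus_delta_cos_gt0. Qed.

Let dm : hderiv m (fun t => delta * sin t).
Proof.
apply: hderiv_eq (hderivB (hderivC 1) (hderivZ delta (hderiv_cos hderiv_id))) _ => t.
by ring.
Qed.

Let cm : continuous m. Proof. exact: hderiv_continuous dm. Qed.

Lemma rsj_weight_continuous : continuous rsj_weight.
Proof.
move=> t; apply: cvgV; first by rewrite mulf_neq0 ?m_neq0 ?gt_eqF.
by apply: cvgMl_tmp; exact: cm.
Qed.

Lemma rsj_weight_periodic : periodic rsj_weight tau.
Proof. by move=> t; rewrite /rsj_weight cosD2pi. Qed.

(** The ratio of the axes of an ellipse of eccentricity delta. *)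
Definition axis_ratio : R := Num.sqrt (1 - delta ^+ 2).

Lemma axis_ratio_sqr : axis_ratio ^+ 2 = 1 - delta ^+ 2.
Proof.
case/andP: delta_itv => d0 d1; rewrite sqr_sqrtr // subr_ge0 expr_le1 //; exact: ltW.
Qed.

Lemma axis_ratio_gt0 : 0 < axis_ratio.
Proof.
by case/andP: delta_itv => d0 d1; rewrite sqrtr_gt0 subr_gt0 expr_lt1 // ltW.
Qed.

Definition true_anomaly_rate (t : R) : R := axis_ratio / (1 - delta * cos t).
Definition true_anomaly : R -> R := prim true_anomaly_rate.

Lemma true_anomaly_rate_gt0 t : 0 < true_anomaly_rate t.
Proof. by rewrite divr_gt0 ?axis_ratio_gt0 // one_minus_delta_cos_gt0. Qed.

Lemma true_anomaly_rate_continuous : continuous true_anomaly_rate.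
Proof. by move=> t; apply: cvgMl_tmp; apply: cvgV; [exact: m_neq0|exact: cm]. Qed.

Lemma true_anomaly_deriv : hderiv true_anomaly true_anomaly_rate.
Proof. exact: hderiv_prim true_anomaly_rate_continuous. Qed.

Lemma true_anomaly0 : true_anomaly 0 = 0.
Proof. exact: prim0 true_anomaly_rate_continuous. Qed.

(** The right-hand sides are a point of the unit circle that rotates with
    angular velocity [true_anomaly_rate], starting from angle 0: these are
    Kepler's formulas for the true anomaly. *)
Lemma true_anomaly_cos_sin t :
  cos (true_anomaly t) = (cos t - delta) / (1 - delta * cos t) /\
  sin (true_anomaly t) = axis_ratio * sin t / (1 - delta * cos t).
Proof.
pose c s := (cos s - delta) / m s; pose z s := axis_ratio * sin s / m s.
have mV := hderivV m_neq0 dm.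
have e2 s : axis_ratio ^+ 2 = 1 - delta ^+ 2 by exact: axis_ratio_sqr.
have dc : hderiv c (fun s => - z s * true_anomaly_rate s).
  have dcs := hderivB (hderiv_cos (@hderiv_id R)) (hderivC delta).
  apply: hderiv_eq (hderivM dcs mV) _ => s.
  have ms := m_neq0 s; rewrite /z /true_anomaly_rate -/(m s).
  have -> : - (axis_ratio * sin s / m s) * (axis_ratio / m s) = - sin s * axis_ratio ^+ 2 / m s ^+ 2 by field.
  by rewrite axis_ratio_sqr; move: ms; rewrite /m => ms; field.
have dz : hderiv z (fun s => c s * true_anomaly_rate s).
  have dsn := hderivZ axis_ratio (hderiv_sin (@hderiv_id R)).
  apply: hderiv_eq (hderivM dsn mV) _ => s.
  have ms := m_neq0 s; rewrite /c /true_anomaly_rate -/(m s).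
  have -> : axis_ratio * sin s * (- (delta * sin s) / m s ^+ 2) + (m s)^-1 * (axis_ratio * (cos s * 1)) =
    axis_ratio * (cos s * m s - delta * sin s ^+ 2) / m s ^+ 2 by field.
  by rewrite sin2cos2; move: ms; rewrite /m => ms; field.
pose w s := (cos (true_anomaly s) - c s) ^+ 2 + (sin (true_anomaly s) - z s) ^+ 2.
have d1 := hderivB (hderiv_cos true_anomaly_deriv) dc.
have d2 := hderivB (hderiv_sin true_anomaly_deriv) dz.
have dw : hderiv w (fun=> 0).
  apply: hderiv_eq (hderivD (hderivM d1 d1) (hderivM d2 d2)) _ => s.
  by ring.
have w0 : w t = 0.
  rewrite (hderiv0_cst t 0 dw) /w true_anomaly0 cos0 sin0 /c /z /m cos0 sin0.
  rewrite mulr0 mul0r subrr mulr1 divff ?subrr ?expr0n ?addr0 //.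
  by have := m_neq0 0; rewrite /m cos0 mulr1.
move/eqP: w0; rewrite /w paddr_eq0 ?sqr_ge0 // !sqrf_eq0 !subr_eq0.
by case/andP => /eqP -> /eqP ->.
Qed.

Lemma cis_true_anomaly_tau : cis (true_anomaly tau) = 1.
Proof.
rewrite /cis; have [-> ->] := true_anomaly_cos_sin tau.
rewrite cos2pi sin2pi mulr0 mul0r mulr1 divff //.
by have := m_neq0 0; rewrite /m cos0 mulr1.
Qed.

(** It makes the kernels (1 + cos u)^N concentrate at t = 0 modulo 2 pi. *)
Lemma cos_true_anomaly_le t : cos (true_anomaly t) <= cos t.
Proof.
have [-> _] := true_anomaly_cos_sin t.
rewrite ler_pdivrMr ?one_minus_delta_cos_gt0 //.
case/andP: delta_itv => d0 _.
by rewrite mulrBr mulr1 lerD2l lerN2 mulrCA -[leRHS]mulr1 ler_wpM2l ?(ltW d0).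
Qed.

Lemma true_anomaly_tau_gt0 : 0 < true_anomaly tau.
Proof.
rewrite -true_anomaly0; apply: (hderiv_gt0_lt true_anomaly_deriv tau_gt0) => t _.
exact: true_anomaly_rate_gt0.
Qed.

End Weights.

(** * Modes and their Fourier coefficients *)

Section Symbol.
Import Normc.
Local Open Scope complex_scope.
Context {R : realType}.
Variables (k B d A E D : R).
Local Notation C := R[i].

(** The symbols are the coefficients, on the wave of real frequency v, of the
    differential operator satisfied by the component y of a mode: [symbol_up]
    for the part that raises the frequency by one, [symbol_down] for the part that
    lowers it, [symbol_mid] for the rest.  Here k is the coupling constant, d the
    eccentricity and E the axis ratio. *)
Definition symbol_re (v : R) : R := - v ^+ 2 + k * B * v - k ^+ 2 / 4.
Definition symbol_up (v : R) : C := Complex (d / 2 * symbol_re v) (- (k * A * E / 2 * v)).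
Definition symbol_down (v : R) : C := Complex (d / 2 * symbol_re v) (k * A * E / 2 * v).
Definition symbol_mid (v : R) : C := (symbol_re v + D * E * v)%:C.

(** The hypothesis is the Fourier form of the first order system for (x, y), with
    the coefficients of x and of its derivative already expressed through those
    of y. *)
Lemma symbol_elimination (v0 v1 v2 : R) (Y0 Y1 Y2 : C) : k != 0 ->
  let X v Y := - (2 * v / k)%:C * Y in let V v Y := im * v%:C * X v Y in
  V v1 Y1 + (d / 2)%:C * (V v0 Y0 + V v2 Y2) =
    im * (k * B)%:C * (X v1 Y1 + (d / 2)%:C * (X v0 Y0 + X v2 Y2)) +
    im * (k * A * E)%:C * (- (im * (2^-1)%:C) * (X v0 Y0 - X v2 Y2)) +
    im * (D * E)%:C * X v1 Y1 +
    im * (k / 2)%:C * (Y1 + (d / 2)%:C * (Y0 + Y2)) ->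
  symbol_up v0 * Y0 + symbol_mid v1 * Y1 + symbol_down v2 * Y2 = 0.
Proof.
move=> k0 X V /eqP; rewrite /X /V; case: Y0 Y1 Y2 => [a0 b0] [a1 b1] [a2 b2].
rewrite eq_complex /= => /andP[/eqP h1 /eqP h2].
apply: complex_eq => /=.
- move/eqP: h2; rewrite -subr_eq0 => /eqP h2.
  rewrite -[RHS](mulr0 (k / 2)) -[X in _ = _ * X]h2 /symbol_re; field; exact: k0.
- move/eqP: h1; rewrite -subr_eq0 => /eqP h1.
  rewrite -[RHS](mulr0 (- (k / 2))) -[X in _ = _ * X]h1 /symbol_re; field; exact: k0.
Qed.

Definition up_vel : C := Complex 0 (- (d * k / 4)).
Definition up_x : C := Complex (- (d * k ^+ 2 * B / 4)) (k ^+ 2 * A * E / 4).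
Definition up_y : C := Complex (- (d * k ^+ 2 / 8)) 0.

(** It trades powers of the frequency for coefficients of derivatives, which are
    bounded. *)
Lemma symbol_up_expansion (v : R) (Y : C) : k != 0 ->
  let X := - (2 * v / k)%:C * Y in let V := im * v%:C * X in
  symbol_up v * Y = up_vel * V + up_x * X + up_y * Y.
Proof.
move=> k0 /=; case: Y => p q; apply: complex_eq => /=; rewrite /symbol_re; field; exact: k0.
Qed.

(** The imaginary part vanishes at v = 0 only, where the real part is
    - d k^2 / 8. *)
Lemma symbol_up_neq0 (v : R) : k != 0 -> d != 0 -> A != 0 -> E != 0 -> symbol_up v != 0.
Proof.
move=> k0 d0 A0 E0; rewrite eq_complex /= negb_and oppr_eq0.
have two0 : (2 : R)^-1 != 0 by rewrite invr_eq0 pnatr_eq0.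
have [->|v0] := eqVneq v 0; apply/orP; [left|right]; last by rewrite !mulf_neq0.
have -> : d / 2 * symbol_re 0 = - (d * k ^+ 2) / 2 / 4 by rewrite /symbol_re; field.
by rewrite !mulf_neq0 ?oppr_eq0 ?mulf_neq0 ?expf_neq0 // invr_eq0 pnatr_eq0.
Qed.

Lemma symbol_downE v : normc (symbol_down v) = normc (symbol_up v).
Proof. by rewrite /normc /= sqrrN. Qed.

End Symbol.

Section Modes.
Import Normc.
Local Open Scope complex_scope.
Context {R : realType}.
Local Notation C := R[i].
Variables (omega delta A B D mu : R).
Hypotheses (omega_gt0 : 0 < omega) (delta_itv : 0 < delta < 1) (A_neq0 : A != 0).

Local Notation E := (axis_ratio delta).
Local Notation u := (true_anomaly delta).
Local Notation du := (true_anomaly_rate delta).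
Definition coupling : R := (omega * E)^-1.
Local Notation coef := (fcoef u du mu).
Local Notation nu n := (n%:~R + mu).

Let E0 : E != 0. Proof. by rewrite gt_eqF // axis_ratio_gt0. Qed.
Let m0 t : 1 - delta * cos t != 0.
Proof. by rewrite gt_eqF // one_minus_delta_cos_gt0. Qed.

Lemma coupling_gt0 : 0 < coupling.
Proof. by rewrite invr_gt0 mulr_gt0 // axis_ratio_gt0. Qed.

Definition mode_drift (t : R) : R := coupling * (B + A * sin t) + D * (1 - delta * cos t) / E.
Definition mode_drift' (t : R) : R :=
  (coupling * A * cos t + D * delta * sin t / E) * (1 - delta * cos t) / E.

Definition mode_velocity (x y : R -> C) (t : R) : C :=
  im * (mode_drift t)%:C * x t + im * (coupling / 2)%:C * y t.
Definition mode_acceleration (x y : R -> C) (t : R) : C :=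
  im * (mode_drift' t)%:C * x t + im * (mode_drift t)%:C * mode_velocity x y t + (coupling / 2 * (coupling / 2))%:C * x t.

(** The linear system in complex form, written with derivatives in the true
    anomaly u: dx/du = i drift x + i (k/2) y and dy/du = - i (k/2) x. *)
Definition mode (x y : R -> C) :=
  [/\ cderiv x (fun t => (du t)%:C * mode_velocity x y t),
      cderiv y (fun t => (du t)%:C * (- im * (coupling / 2)%:C * x t)),
      quasiperiodic u mu x & quasiperiodic u mu y].

Lemma mode_lin x1 y1 x2 y2 (z w : C) : mode x1 y1 -> mode x2 y2 ->
  mode (fun t => z * x1 t + w * x2 t) (fun t => z * y1 t + w * y2 t).
Proof.
move=> [dx1 dy1 qx1 qy1] [dx2 dy2 qx2 qy2]; split.
- apply: cderiv_eq (cderivD (cderivZ z dx1) (cderivZ w dx2)) _ => t.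
  by rewrite /mode_velocity; ring.
- by apply: cderiv_eq (cderivD (cderivZ z dy1) (cderivZ w dy2)) _ => t; ring.
- by rewrite /quasiperiodic qx1 qx2; ring.
- by rewrite /quasiperiodic qy1 qy2; ring.
Qed.

Let drift_deriv : hderiv mode_drift (fun t => du t * mode_drift' t).
Proof.
have d1 := hderivZ coupling (hderivD (hderivC B) (hderivZ A (hderiv_sin (@hderiv_id R)))).
have d2 := hderivZ (D / E) (hderivB (hderivC 1) (hderivZ delta (hderiv_cos (@hderiv_id R)))).
apply: hderiv_congr (hderivD d1 d2) _ _ => t; first by rewrite /mode_drift; ring.
rewrite /mode_drift' /true_anomaly_rate; have := m0 t; move: (sin t) (cos t) => s c h1.
by field; rewrite h1 E0.
Qed.

Let cdrift : ccontinuous (fun t => (mode_drift t)%:C).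
Proof. exact: ccontinuous_real (hderiv_continuous drift_deriv). Qed.

Let cdrift' : ccontinuous (fun t => (mode_drift' t)%:C).
Proof.
have dm := hderivB (hderivC 1) (hderivZ delta (hderiv_cos (@hderiv_id R))).
have dl := hderivD (hderivZ (coupling * A) (hderiv_cos (@hderiv_id R)))
  (hderivZ (D * delta / E) (hderiv_sin (@hderiv_id R))).
have := ccontinuous_real (hderiv_continuous (hderivZ E^-1 (hderivM dl dm))).
by congr ccontinuous; apply/funext => t; congr (_ %:C); rewrite /mode_drift'; ring.
Qed.

Let cdu := true_anomaly_rate_continuous delta_itv.
Let du_deriv := true_anomaly_deriv delta_itv.

Let coef_lin F G (z w : C) j : ccontinuous F -> ccontinuous G ->
  coef (fun t => z * F t + w * G t) j = z * coef F j + w * coef G j.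
Proof.
move=> cF cG.
rewrite (fcoefD mu du_deriv cdu j (ccontinuousM (ccontinuous_cst z) cF)
  (ccontinuousM (ccontinuous_cst w) cG)).
by rewrite (fcoefZ mu du_deriv cdu z j cF) (fcoefZ mu du_deriv cdu w j cG).
Qed.

Section OneMode.
Variables (x y : R -> C).
Hypothesis xy : mode x y.

Let dx : cderiv x (fun t => (du t)%:C * mode_velocity x y t). Proof. by case: xy. Qed.
Let dy : cderiv y (fun t => (du t)%:C * (- im * (coupling / 2)%:C * x t)). Proof. by case: xy. Qed.
Let qx : quasiperiodic u mu x. Proof. by case: xy. Qed.
Let qy : quasiperiodic u mu y. Proof. by case: xy. Qed.

Lemma mode_ccontinuous : ccontinuous x /\ ccontinuous y.
Proof. by split; [exact: cderiv_continuous dx|exact: cderiv_continuous dy]. Qed.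
Let cx := mode_ccontinuous.1.
Let cy := mode_ccontinuous.2.

Let cvel : ccontinuous (mode_velocity x y).
Proof.
apply: ccontinuousD; apply: ccontinuousM => //; last exact: ccontinuous_cst.
by apply: ccontinuousM => //; exact: ccontinuous_cst.
Qed.

Let cacc : ccontinuous (mode_acceleration x y).
Proof.
apply: ccontinuousD; last by apply: ccontinuousM => //; exact: ccontinuous_cst.
by apply: ccontinuousD; apply: ccontinuousM => //; apply: ccontinuousM => //;
  exact: ccontinuous_cst.
Qed.

Let dvel : cderiv (mode_velocity x y) (fun t => (du t)%:C * mode_acceleration x y t).
Proof.
have d1 := cderivM (cderivZ im (cderiv_real drift_deriv)) dx.
have d2 := cderivZ (im * (coupling / 2)%:C) dy.
apply: cderiv_eq (cderivD d1 d2) _ => t.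
have ii : im * im = -1 :> C by rewrite -expr2 sqr_i.
have -> : im * (coupling / 2)%:C * ((du t)%:C * (- im * (coupling / 2)%:C * x t)) =
  - (im * im) * ((coupling / 2)%:C * (coupling / 2)%:C) * (du t)%:C * x t by ring.
by rewrite ii /mode_acceleration !rmorphM /=; ring.
Qed.

Let qvel : quasiperiodic u mu (mode_velocity x y).
Proof.
have dp : mode_drift tau = mode_drift 0.
  by rewrite /mode_drift -[tau]add0r sinD2pi cosD2pi.
by rewrite /quasiperiodic /mode_velocity qx qy dp; ring.
Qed.

Let coef_d F G n : cderiv F (fun t => (du t)%:C * G t) -> ccontinuous G ->
  quasiperiodic u mu F -> coef G n = im * (nu n)%:C * coef F n.
Proof.
exact: (fcoef_deriv du_deriv cdu (true_anomaly0 delta_itv) (cis_true_anomaly_tau delta_itv) n).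
Qed.

Lemma mode_coefs n :
  [/\ coef x n = - (2 * nu n / coupling)%:C * coef y n,
      coef (mode_velocity x y) n = im * (nu n)%:C * coef x n &
      coef (mode_acceleration x y) n = im * (nu n)%:C * coef (mode_velocity x y) n].
Proof.
split; last 2 first.
- exact: coef_d dx cvel qx.
- exact: coef_d dvel cacc qvel.
have cxk : ccontinuous (fun t => - im * (coupling / 2)%:C * x t).
  by apply: ccontinuousM => //; exact: ccontinuous_cst.
have := coef_d n dy cxk qy.
rewrite (fcoefZ mu du_deriv cdu _ n cx) => e.
have i0 : im != 0 :> C by rewrite eq_complex /= oner_eq0 andbF.
have k1 : (2 / coupling)%:C * (coupling / 2)%:C = 1 :> C.
  by rewrite -rmorphM /= (_ : 2 / coupling * (coupling / 2) = 1) //; field; rewrite gt_eqF // coupling_gt0.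
apply: (mulfI i0); rewrite -[LHS]mul1r -k1.
rewrite (_ : 2 * nu n / coupling = 2 / coupling * nu n); last by ring.
rewrite [(2 / coupling * _)%:C]rmorphM /=.
transitivity (- (2 / coupling)%:C * (- im * (coupling / 2)%:C * coef x n)); first by ring.
by rewrite e; ring.
Qed.

(** Multiplied by 1 + delta cos u, the system has trigonometric coefficients of
    degree one in u. *)
Lemma mode_recurrence n :
  symbol_up coupling B delta A E (nu (n - 1)) * coef y (n - 1) +
  symbol_mid coupling B E D (nu n) * coef y n +
  symbol_down coupling B delta A E (nu (n + 1)) * coef y (n + 1) = 0.
Proof.
apply: symbol_elimination; first by rewrite gt_eqF // coupling_gt0.
have [<- e1 _] := mode_coefs n; have [<- e0 _] := mode_coefs (n - 1).
have [<- e2 _] := mode_coefs (n + 1); rewrite -e0 -e1 -e2.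
pose q t := 1 + delta * cos (u t).
have hq : continuous q := hderiv_continuous
  (hderivD (hderivC 1) (hderivZ delta (hderiv_cos du_deriv))).
have hs : continuous (fun t => sin (u t)) := hderiv_continuous (hderiv_sin du_deriv).
have ccu := cderiv_continuous (cderiv_cis du_deriv).
have ccNu := cderiv_continuous (cderiv_cis (hderivN du_deriv)).
have cq F : ccontinuous F -> ccontinuous (fun t => (q t)%:C * F t).
  by move=> cF; exact: ccontinuousM (ccontinuous_real hq) cF.
have cs F : ccontinuous F -> ccontinuous (fun t => (sin (u t))%:C * F t).
  by move=> cF; exact: ccontinuousM (ccontinuous_real hs) cF.
have coef_trig F (z w : C) : ccontinuous F ->
    coef (fun t => z * (cis (u t) * F t) + w * (cis (- u t) * F t)) n =
    z * coef F (n - 1) + w * coef F (n + 1).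
  move=> cF; rewrite (coef_lin z w n (ccontinuousM ccu cF) (ccontinuousM ccNu cF)).
  by rewrite fcoef_shiftr fcoef_shiftl.
have coef_q F : ccontinuous F -> coef (fun t => (q t)%:C * F t) n =
    coef F n + (delta / 2)%:C * (coef F (n - 1) + coef F (n + 1)).
  move=> cF; have cF1 := ccontinuousM ccu cF; have cF2 := ccontinuousM ccNu cF.
  have -> : (fun t => (q t)%:C * F t) = (fun t => F t + ((delta / 2)%:C * (cis (u t) * F t) +
      (delta / 2)%:C * (cis (- u t) * F t))).
    apply/funext => t.
    transitivity ((1 + (delta / 2)%:C * (cis (u t) + cis (- u t))) * F t); last by ring.
    congr (_ * _).
    by apply: complex_eq; rewrite /q /= ?cosN ?sinN; field.
  rewrite (fcoefD mu du_deriv cdu n cF (ccontinuousD (ccontinuousM (ccontinuous_cst _) cF1)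
    (ccontinuousM (ccontinuous_cst _) cF2))) coef_trig //.
  by rewrite mulrDr.
have coef_s F : ccontinuous F -> coef (fun t => (sin (u t))%:C * F t) n =
    - (im * (2^-1)%:C) * (coef F (n - 1) - coef F (n + 1)).
  move=> cF.
  have -> : (fun t => (sin (u t))%:C * F t) = (fun t => - (im * (2^-1)%:C) * (cis (u t) * F t) +
      (im * (2^-1)%:C) * (cis (- u t) * F t)).
    apply/funext => t; rewrite !mulrA -mulrDl; congr (_ * _).
    by apply: complex_eq; rewrite /= ?cosN ?sinN; field.
  by rewrite coef_trig //; ring.
have real_id t : q t * mode_drift t = coupling * B * q t + coupling * A * E * sin (u t) + D * E.
  have [e3 e4] := true_anomaly_cos_sin delta_itv t.
  rewrite /q e3 e4 /mode_drift; have := m0 t; move: (sin t) (cos t) => s c h.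
  have -> : 1 + delta * ((c - delta) / (1 - delta * c)) = E ^+ 2 / (1 - delta * c).
    by rewrite axis_ratio_sqr //; field.
  by move: coupling => k; field; rewrite h E0.
have fun_id : (fun t => (q t)%:C * mode_velocity x y t) = (fun t =>
    1 * (im * (coupling * B)%:C * ((q t)%:C * x t) + im * (coupling * A * E)%:C * ((sin (u t))%:C * x t)) +
    1 * (im * (D * E)%:C * x t + im * (coupling / 2)%:C * ((q t)%:C * y t))).
  apply/funext => t; rewrite /mode_velocity mulrDr; move: (real_id t).
  move: (q t) (mode_drift t) (sin (u t)) => qt dr st eid.
  have -> : qt%:C * (im * dr%:C * x t) = im * (qt * dr)%:C * x t.
    by rewrite rmorphM /=; ring.
  rewrite eid !rmorphD /= [(coupling * B * qt)%:C]rmorphM [(coupling * A * E * st)%:C]rmorphM /=.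
  by ring.
have e := coef_q _ cvel; rewrite fun_id in e.
rewrite -e coef_lin; last 2 first.
- by apply: ccontinuousD; apply: ccontinuousM; try exact: ccontinuous_cst; [exact: cq|exact: cs].
- by apply: ccontinuousD; apply: ccontinuousM; try exact: ccontinuous_cst; [exact: cx|exact: cq].
rewrite (coef_lin _ _ _ (cq _ cx) (cs _ cx)) (coef_lin _ _ _ cx (cq _ cy)).
by rewrite !mul1r coef_q // coef_q // coef_s // !addrA.
Qed.

(** The products are combinations of coefficients of x, y and of two derivatives
    of x, hence bounded. *)
Lemma mode_decay : exists M, forall n,
  normc (symbol_up coupling B delta A E (nu n) * coef y n) <= M /\
  `|nu n| * normc (symbol_up coupling B delta A E (nu n) * coef y n) <= M.
Proof.
have k0 : coupling != 0 by rewrite gt_eqF // coupling_gt0.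
have [M1 h1] := fcoef_bounded mu du_deriv cdu cacc.
have [M2 h2] := fcoef_bounded mu du_deriv cdu cvel.
have [M3 h3] := fcoef_bounded mu du_deriv cdu cx.
have [M4 h4] := fcoef_bounded mu du_deriv cdu cy.
pose c1 := up_vel coupling delta; pose c2 := up_x coupling B delta A E; pose c3 := up_y coupling delta.
have bound (z1 z2 z3 : C) (N1 N2 N3 : R) : normc z1 <= N1 -> normc z2 <= N2 -> normc z3 <= N3 ->
    normc (c1 * z1 + c2 * z2 + c3 * z3) <= normc c1 * N1 + normc c2 * N2 + normc c3 * N3.
  move=> b1 b2 b3; apply: le_trans (le_normcD _ _) _; apply: lerD.
    by apply: le_trans (le_normcD _ _) _; apply: lerD; rewrite normcM ler_wpM2l // normc_ge0.
  by rewrite normcM ler_wpM2l // normc_ge0.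
have PE n : symbol_up coupling B delta A E (nu n) * coef y n =
    c1 * coef (mode_velocity x y) n + c2 * coef x n + c3 * coef y n.
  have [ex ev _] := mode_coefs n.
  by rewrite (symbol_up_expansion _ _ _ _ _ _ k0) -ex -ev.
pose N1 := normc c1 * M2 + normc c2 * M3 + normc c3 * M4.
pose N2 := normc c1 * M1 + normc c2 * M2 + normc c3 * (coupling / 2 * M3).
have N1_ge0 : 0 <= N1 by apply: le_trans (normc_ge0 _) (bound _ _ _ _ _ _ (h2 0) (h3 0) (h4 0)).
have k20 : 0 <= coupling / 2 by rewrite divr_ge0 // ltW // coupling_gt0.
have normc_real (r : R) : normc r%:C = `|r| by rewrite /= expr0n addr0 sqrtr_sqr.
have h3' n : normc (- (coupling / 2)%:C * coef x n) <= coupling / 2 * M3.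
  by rewrite normcM normcN normc_real ger0_norm // ler_wpM2l.
have normc_im : normc (- im : C) = 1.
  by rewrite normcN /= expr0n add0r expr1n sqrtr1.
(* multiplying a coefficient by the frequency amounts to differentiating, up to -i *)
have rot M (z : C) : normc z <= M -> normc (- im * z) <= M by rewrite normcM normc_im mul1r.
have N2_ge0 : 0 <= N2 by apply: le_trans (normc_ge0 _) (bound _ _ _ _ _ _ (h1 0) (h2 0) (h3' 0)).
exists (N1 + N2) => n; split.
  by rewrite PE; apply: le_trans (bound _ _ _ _ _ _ (h2 n) (h3 n) (h4 n)) _; rewrite lerDl.
rewrite -normc_real -normcM PE.
have [ex ev ea] := mode_coefs n.
have -> : (nu n)%:C * (c1 * coef (mode_velocity x y) n + c2 * coef x n + c3 * coef y n) =
    c1 * (- im * coef (mode_acceleration x y) n) + c2 * (- im * coef (mode_velocity x y) n) +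
    c3 * (- (coupling / 2)%:C * coef x n).
  have ii (z : C) : - im * (im * z) = z.
    by rewrite mulrA mulNr; case: z => p q; apply: complex_eq => /=; ring.
  have e1 : - im * coef (mode_acceleration x y) n = (nu n)%:C * coef (mode_velocity x y) n.
    by rewrite ea -mulrA ii.
  have e2 : - im * coef (mode_velocity x y) n = (nu n)%:C * coef x n.
    by rewrite ev -mulrA ii.
  have e3 : - (coupling / 2)%:C * coef x n = (nu n)%:C * coef y n.
    rewrite ex mulrA mulrNN; congr (_ * _); rewrite -rmorphM /=; congr (_ %:C).
    by move: coupling k0 => k k0; field.
  by rewrite e1 e2 e3; ring.
apply: le_trans (bound _ _ _ _ _ _ (rot _ _ (h1 n)) (rot _ _ (h2 n)) (h3' n)) _.
by rewrite lerDr.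
Qed.

(** The recurrence propagates two consecutive zeros in both directions. *)
Lemma mode_vanish : coef y 0 = 0 -> coef y 1 = 0 -> x 0 = 0 /\ y 0 = 0.
Proof.
move=> y0 y1.
have k0 : coupling != 0 by rewrite gt_eqF // coupling_gt0.
have d0 : delta != 0 by rewrite gt_eqF //; case/andP: delta_itv.
have up0 v : symbol_up coupling B delta A E v != 0 by exact: symbol_up_neq0.
have down0 v : symbol_down coupling B delta A E v != 0.
  apply/eqP => e; have /eqP := up0 v; apply; apply: eq0_normc.
  by rewrite -symbol_downE e normc0.
have pos (n : nat) : coef y n = 0 /\ coef y (n%:Z + 1) = 0.
  elim: n => [//|n [ih0 ih1]]; rewrite -addn1 PoszD; split=> //.
  have := mode_recurrence (n%:Z + 1); rewrite addrK ih0 ih1 !mulr0 !add0r => /eqP.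
  by rewrite mulf_eq0 (negbTE (down0 _)) => /eqP.
have neg (n : nat) : coef y (- n%:Z) = 0 /\ coef y (- n%:Z + 1) = 0.
  elim: n => [|n [ih0 ih1]]; first by rewrite oppr0.
  rewrite -addn1 PoszD opprD; split; last by rewrite subrK.
  have := mode_recurrence (- n%:Z); rewrite ih0 ih1 !mulr0 !addr0 => /eqP.
  by rewrite mulf_eq0 (negbTE (up0 _)) => /eqP.
have ally n : coef y n = 0.
  by case: n => n; [have [] := pos n|rewrite NegzE; have [] := neg n.+1].
have allx n : coef x n = 0 by have [-> _ _] := mode_coefs n; rewrite ally mulr0.
have uniq F : ccontinuous F -> quasiperiodic u mu F -> (forall n, coef F n = 0) -> F 0 = 0.
  apply: (fourier_uniqueness0 du_deriv cdu (true_anomaly_rate_gt0 delta_itv)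
    (true_anomaly0 delta_itv) (cis_true_anomaly_tau delta_itv)) => t _.
  exact: cos_true_anomaly_le delta_itv t.
by split; apply: uniq.
Qed.

End OneMode.

Section TwoModes.
Variables (x1 y1 x2 y2 : R -> C).
Hypotheses (m1 : mode x1 y1) (m2 : mode x2 y2).
Local Notation c := (coef y1).
Local Notation d := (coef y2).
Local Notation P n := (symbol_up coupling B delta A E (nu n)).

Definition casoratian (n : int) : C := c n * d (n + 1) - c (n + 1) * d n.

Let V (n : int) : R := normc (P n) * normc (P (n + 1)) * normc (casoratian n).

Let V_step n : V (n + 1) = V n.
Proof.
have := mode_recurrence m1 (n + 1); have := mode_recurrence m2 (n + 1).
rewrite addrK /V => r2 r1.
have e : symbol_down coupling B delta A E (nu (n + 1 + 1)) * casoratian (n + 1) = P n * casoratian n.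
  rewrite /casoratian; move: r1 r2.
  move: (symbol_up _ _ _ _ _ _) (symbol_mid _ _ _ _ _) (symbol_down _ _ _ _ _ _) => p q s r1 r2.
  apply/eqP; rewrite -subr_eq0; apply/eqP.
  transitivity ((p * d n + q * d (n + 1) + s * d (n + 1 + 1)) * c (n + 1) -
    (p * c n + q * c (n + 1) + s * c (n + 1 + 1)) * d (n + 1)); first by ring.
  by rewrite r1 r2 !mul0r subrr.
have := congr1 (@normc R) e; rewrite !normcM symbol_downE => en.
by rewrite -mulrA en; ring.
Qed.

(** The recurrence and the equality of the moduli of [symbol_up] and
    [symbol_down] make V constant; [mode_decay] bounds (n + mu) V n. *)
Lemma casoratian_eq0 : casoratian 0 = 0.
Proof.
have V_cst (n : nat) : V n = V 0.
  by elim: n => [//|n <-]; rewrite -(V_step n) -PoszD addn1.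
have [M1 h1] := mode_decay m1; have [M2 h2] := mode_decay m2.
have bound (n : nat) : `|nu n| * V 0 <= M1 * M2 + M1 * M2.
  rewrite -(V_cst n) /V /casoratian.
  have [_ c0] := h1 n; have [c1 _] := h1 (n%:Z + 1).
  have [_ d0] := h2 n; have [d1 _] := h2 (n%:Z + 1).
  have := le_normcD (c n * d (n%:Z + 1)) (- (c (n%:Z + 1) * d n)).
  rewrite normcN !normcM => hW; rewrite !normcM in c0 c1 d0 d1.
  have g z : 0 <= normc z := @normc_ge0 R z.
  set p := normc (P n) in c0 d0 *; set p1 := normc (P (n%:Z + 1)) in c1 d1 *.
  set C0 := normc (c n) in hW c0; set C1 := normc (c (n%:Z + 1)) in hW c1.
  set D0 := normc (d n) in hW d0; set D1 := normc (d (n%:Z + 1)) in hW d1.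
  have pp : 0 <= `|nu n| * (p * p1) by rewrite !mulr_ge0 ?g.
  rewrite mulrA; apply: le_trans (ler_wpM2l pp hW) _.
  have -> : `|nu n| * (p * p1) * (C0 * D1 + C1 * D0) =
    (`|nu n| * (p * C0)) * (p1 * D1) + (p1 * C1) * (`|nu n| * (p * D0)) by ring.
  by apply: lerD; apply: ler_pM => //; rewrite !mulr_ge0 ?g.
have V0 : V 0 <= 0.
  apply: (@linear_le_bounded _ _ (M1 * M2 + M1 * M2 + `|mu| * V 0)) => n.
  have Vge : 0 <= V 0 by rewrite !mulr_ge0 // normc_ge0.
  have hn : n%:R <= `|nu n| + `|mu| :> R.
    have := ler_norm (nu n); have := ler_norm (- mu); rewrite normrN.
    by rewrite -[n%:~R]/(n%:R); lra.
  have := ler_wpM2l Vge hn; have := bound n; rewrite mulrDr ![V 0 * _]mulrC.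
  by lra.
have Pgt n : 0 < normc (P n).
  rewrite lt_neqAle normc_ge0 andbT eq_sym; apply/eqP => /eq0_normc/eqP.
  apply/negP; apply: symbol_up_neq0 => //; rewrite gt_eqF ?coupling_gt0 //.
  by case/andP: delta_itv.
apply: eq0_normc; apply/eqP; rewrite eq_le normc_ge0 andbT.
by move: V0; rewrite /V pmulr_rle0 // mulr_gt0 // Pgt.
Qed.

Lemma modes_dependent_at0 : exists z w : C, ((z != 0) || (w != 0)) /\
  z * x1 0 + w * x2 0 = 0 /\ z * y1 0 + w * y2 0 = 0.
Proof.
have W0 := casoratian_eq0; rewrite /casoratian add0r in W0.
have [z [w [zw0 [e0 e1]]]] : exists z w : C, ((z != 0) || (w != 0)) /\
    z * c 0 + w * d 0 = 0 /\ z * c 1 + w * d 1 = 0.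
  have [/andP[/eqP d0 /eqP c0]|h0] := boolP ((d 0 == 0) && (c 0 == 0)); last first.
    exists (d 0), (- c 0); split; first by rewrite oppr_eq0 -negb_and.
    by split; [ring|rewrite -[RHS]oppr0 -[X in _ = - X]W0; ring].
  have [/andP[/eqP d1 /eqP c1]|h1] := boolP ((d 1 == 0) && (c 1 == 0)); last first.
    exists (d 1), (- c 1); split; first by rewrite oppr_eq0 -negb_and.
    by split; rewrite ?d0 ?c0; ring.
  by exists 1, 0; rewrite c0 c1 d0 d1 !mulr0 addr0 oner_eq0.
exists z, w; split=> //.
have cy1 := (mode_ccontinuous m1).2; have cy2 := (mode_ccontinuous m2).2.
apply: (mode_vanish (mode_lin z w m1 m2)); by rewrite (coef_lin _ _ _ cy1 cy2).
Qed.

End TwoModes.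

End Modes.

(** * A trivial period map has zero amplitude *)

Definition rsj_drift (R : realType) (omega delta D B A t : R) : R :=
  (B + A * sin t) * rsj_weight omega delta t + D.

Section Monodromy.
Import Normc.
Local Open Scope complex_scope.
Context {R : realType}.
Local Notation C := R[i].
Variables (omega delta D B A : R).
Hypotheses (omega_gt0 : 0 < omega) (delta_itv : 0 < delta < 1).
Local Notation a := (rsj_weight omega delta).
Local Notation b := (rsj_drift omega delta D B A).
Local Notation f := (phase_field a b).

Let ca := rsj_weight_continuous omega_gt0 delta_itv.
Let pa := @rsj_weight_periodic R omega delta.

Lemma rsj_drift_continuous : continuous b.
Proof.
move=> t; apply: cvgD; last exact: cvg_cst.
apply: cvgM; last exact: ca.
by apply: cvgD; [exact: cvg_cst|apply: cvgMl_tmp; exact: continuous_sin].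
Qed.
Let cb := rsj_drift_continuous.

Lemma rsj_drift_periodic : periodic b tau.
Proof. by move=> t; rewrite /rsj_drift sinD2pi pa. Qed.
Let pb := rsj_drift_periodic.

Local Notation beta := (prim b).
(** With beta a primitive of b, the factor exp (i beta / 2) is the rotating frame
    in which the equation of y involves x only. *)
Definition mode_x (th : R -> R) (t : R) : C :=
  (amplitude a th t)%:C * cis ((beta t + th t) / 2).
Definition mode_y (th : R -> R) (t : R) : C :=
  (amplitude a th t)%:C * cis ((beta t - th t) / 2).

Variable k : int.
Hypothesis trivial_poincare : forall x, poincare a b x = x + tau * k%:~R.

Let mu := (beta tau / 2 + pi * k%:~R) / true_anomaly delta tau.

Let mode_flow x : mode omega delta A B D mu (mode_x (flow a b x)) (mode_y (flow a b x)).
Proof.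
have s := flow_solution ca cb pa pb x; set th := flow a b x in s *.
have dr := cderiv_real (hderiv_amplitude ca s).
have dth := solution_hderiv s; have dbeta := hderiv_prim cb.
have half (g : R -> R) g' : hderiv g g' -> hderiv (fun t => g t / 2) (fun t => g' t / 2).
  by move=> dg; apply: hderiv_congr (hderivZ 2^-1 dg) _ _ => t; rewrite mulrC.
have dp := cderiv_cis (half _ _ (hderivD dbeta dth)).
have dm := cderiv_cis (half _ _ (hderivB dbeta dth)).
have E0 : axis_ratio delta != 0 by rewrite gt_eqF // axis_ratio_gt0.
have rate_drift t : true_anomaly_rate delta t * mode_drift omega delta A B D t = b t.
  have m0 : 1 - delta * cos t != 0 by rewrite gt_eqF // one_minus_delta_cos_gt0.
  rewrite /true_anomaly_rate /mode_drift /rsj_drift /rsj_weight /coupling.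
  by field; rewrite m0 E0 gt_eqF.
have rate_kap t : true_anomaly_rate delta t * (coupling omega delta / 2) = a t / 2.
  have m0 : 1 - delta * cos t != 0 by rewrite gt_eqF // one_minus_delta_cos_gt0.
  rewrite /true_anomaly_rate /rsj_weight /coupling.
  by field; rewrite m0 E0 gt_eqF.
(* the vectors of x and y differ by the phase th *)
have cis_minus t : cis ((beta t - th t) / 2) = cis ((beta t + th t) / 2) * cis (- th t).
  by rewrite -cisD; congr cis; field.
have cis_plus t : cis ((beta t + th t) / 2) = cis ((beta t - th t) / 2) * cis (th t).
  by rewrite -cisD; congr cis; field.
have L0 : true_anomaly delta tau != 0 by rewrite gt_eqF // true_anomaly_tau_gt0.
have muL : mu * true_anomaly delta tau = beta tau / 2 + pi * k%:~R by rewrite /mu divfK.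
have thtau : th tau = x + tau * k%:~R by rewrite -trivial_poincare.
have th0 : th 0 = x by exact: flow0.
have r1 : amplitude a th tau = 1 by exact: (amplitude_tau ca cb pa pb trivial_poincare x).
have r0 : amplitude a th 0 = 1 by exact: (amplitude0 ca s).
have b0 : beta 0 = 0 by exact: prim0.
split.
- apply: cderiv_eq (cderivM dr dp) _ => t.
  transitivity (im * (true_anomaly_rate delta t * mode_drift omega delta A B D t)%:C * mode_x th t +
     im * (true_anomaly_rate delta t * (coupling omega delta / 2))%:C * mode_y th t); last first.
    by rewrite /mode_velocity rmorphM [(_ * (_ / 2))%:C]rmorphM /=; ring.
  rewrite rate_drift rate_kap /mode_x /mode_y cis_minus.
  move: (cis ((beta t + th t) / 2)) => z.
  transitivity ((amplitude a th t)%:C * z * (im * ((b t + f (th t) t) / 2)%:C +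
    (a t * sin (th t) / 2)%:C)); first by rewrite rmorphM /=; ring.
  transitivity ((amplitude a th t)%:C * z * (im * (b t)%:C + im * (a t / 2)%:C * cis (- th t)));
    last by ring.
  congr (_ * _); rewrite /phase_field.
  by apply: complex_eq => /=; rewrite ?cosN ?sinN; field.
- apply: cderiv_eq (cderivM dr dm) _ => t.
  transitivity (- im * (true_anomaly_rate delta t * (coupling omega delta / 2))%:C * mode_x th t); last first.
    by rewrite rmorphM /=; ring.
  rewrite rate_kap /mode_x cis_plus.
  move: (cis ((beta t - th t) / 2)) => z.
  transitivity ((amplitude a th t)%:C * z * (im * ((b t - f (th t) t) / 2)%:C +
    (a t * sin (th t) / 2)%:C)); first by rewrite rmorphM /=; ring.
  transitivity ((amplitude a th t)%:C * z * (- im * (a t / 2)%:C * cis (th t)));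
    last by ring.
  congr (_ * _); rewrite /phase_field.
  by apply: complex_eq => /=; rewrite ?cosN ?sinN; field.
- rewrite /quasiperiodic /mode_x r0 r1 thtau th0 b0 muL !mul1r -cisD.
  by congr cis; field.
- rewrite /quasiperiodic /mode_y r0 r1 thtau th0 b0 muL !mul1r -cisD.
  rewrite -[RHS](cisDtau (- k)) rmorphN /=.
  by congr cis; field.
Qed.

(** The modes of the solutions starting at 0 and at pi have initial values
    (1, 1) and (i, -i), which are linearly independent, against
    [modes_dependent_at0]. *)
Lemma trivial_period_map_amplitude0 : A = 0.
Proof.
apply/eqP; apply/negP => /negP A0.
have [z [w [zw]]] := modes_dependent_at0 omega_gt0 delta_itv A0 (mode_flow 0) (mode_flow pi).
have b0 : beta 0 = 0 by exact: prim0.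
rewrite /mode_x /mode_y b0 !(flow0 ca cb pa pb).
rewrite !(amplitude0 ca (flow_solution ca cb pa pb _)) !mul1r.
rewrite addr0 subrr mul0r cis0 add0r sub0r mulNr.
have -> : cis (pi / 2) = im :> C by rewrite /cis cos_pihalf sin_pihalf.
have -> : cis (- (pi / 2)) = - im :> C.
  by rewrite /cis cosN sinN cos_pihalf sin_pihalf; apply: complex_eq => /=; rewrite ?oppr0.
case: z w zw => [p q] [r s] zw [/eqP e1 /eqP e2]; move: zw e1 e2.
rewrite !eq_complex /= !negb_and => zw /andP[/eqP h1 /eqP h2] /andP[/eqP h3 /eqP h4].
have p0 : p = 0 by lra.
have q0 : q = 0 by lra.
have r0 : r = 0 by lra.
have s0 : s = 0 by lra.
by move: zw; rewrite p0 q0 r0 s0 eqxx.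
Qed.

End Monodromy.

(** * Phase-lock areas *)

Section FiberwiseConnected.
Context {R : realType}.
Implicit Types (U : set (R * R)) (J : set R).

Lemma open_projection U : open U -> open [set s | exists r, U (r, s)].
Proof.
rewrite !openE => oU s [r Urs]; have /nbhs_ballP[e /= e0 he] := oU _ Urs.
apply/nbhs_ballP; exists e => //= s' ss'; exists r; apply: he; split => //=.
exact: ballxx.
Qed.

(** A relatively clopen subset of U is a union of whole fibres, and the
    projections of it and of its complement are open and disjoint. *)
Lemma fiberwise_connected U J : open U -> is_interval J ->
  (forall p, U p -> J p.2) -> (forall s, J s -> exists r, U (r, s)) ->
  (forall s, is_interval [set r | U (r, s)]) -> connected U.
Proof.
move=> oU iJ UJ JU iU V [p0 Vp0] [C oC VC] [F cF VF].
have fiberE s r r' : V (r, s) -> U (r', s) -> V (r', s).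
  move=> Vr Ur'.
  have cpair : continuous (fun r : R => (r, s)).
    move=> z N /nbhs_ballP[e e0 he]; apply/nbhs_ballP; exists e => // y zy.
    by apply: he; split => //; exact: ballxx.
  have /connected_intervalP cI := iU s.
  have e : [set r | V (r, s)] = [set r | U (r, s)].
    apply: cI.
    - by exists r.
    - exists [set r | C (r, s)]; first by move/continuousP: cpair; apply.
      by apply/seteqP; split => z /=; rewrite VC.
    - exists [set r | F (r, s)]; first by move/continuous_closedP: cpair; apply.
      by apply/seteqP; split => z /=; rewrite VF.
  by have : [set r | U (r, s)] r' by []; rewrite -e.
have oV : open V by rewrite VC; exact: openI.
pose W := U `&` ~` F.
have oW : open W by apply: openI => //; exact: closed_openC.
have WV p : U p -> ~ V p -> W p by move=> Up nVp; split=> // Fp; apply: nVp; rewrite VF.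
have VW p : W p -> ~ V p by move=> [_ nF]; rewrite VF => -[].
have cJ : connected J by exact/connected_intervalP.
have VU p : V p -> U p by rewrite VC => -[].
have E : [set s | exists r, V (r, s)] = J.
  apply: cJ.
  - by case: p0 Vp0 => r s Vrs; exists s, r.
  - exists [set s | exists r, V (r, s)]; first exact: open_projection.
    by apply/seteqP; split=> [s [r Vr]|s []//]; split; [exact: (UJ _ (VU _ Vr))|exists r].
  - exists (~` [set s | exists r, W (r, s)]); first by apply: open_closedC; exact: open_projection.
    apply/seteqP; split=> [s [r Vr]|s [/JU[r Ur] nW]].
      split; first exact: (UJ _ (VU _ Vr)).
      by move=> [r' Wr']; apply: (VW _ Wr'); apply: fiberE Vr _; case: Wr'.
    exists r; apply: contrapT => nV; apply: nW; exists r; exact: WV.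
apply/seteqP; split=> [p /VU //|[r s] Up].
have : J s by exact: (UJ _ Up).
by rewrite -E => -[r' /= Vr']; exact: fiberE Vr' Up.
Qed.

End FiberwiseConnected.

Section Family.
Context {R : realType}.
Variables (omega delta D : R).
Hypotheses (omega_gt0 : 0 < omega) (delta_itv : 0 < delta < 1).
Local Notation a := (rsj_weight omega delta).
Local Notation b p := (rsj_drift omega delta D p.1 p.2).
Local Notation f p := (phase_field a (b p)).
Local Notation P p := (poincare a (b p)).

Let ca := rsj_weight_continuous omega_gt0 delta_itv.
Let pa := @rsj_weight_periodic R omega delta.
Let cb (p : R * R) : continuous (b p) := @rsj_drift_continuous R omega delta D p.1 p.2 omega_gt0 delta_itv.
Let pb (p : R * R) : periodic (b p) tau := @rsj_drift_periodic R omega delta D p.1 p.2.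
Let rho (p : R * R) := rotation_number (perturbed_RSJ omega delta D p).

Lemma perturbed_RSJE (p : R * R) : perturbed_RSJ omega delta D p = f p.
Proof.
apply/funext => th; apply/funext => t.
by rewrite /perturbed_RSJ /phase_field /rsj_drift /rsj_weight; ring.
Qed.

Let a_lower t : (2 * omega)^-1 <= a t.
Proof.
have m0 := one_minus_delta_cos_gt0 delta_itv t.
rewrite lef_pV2 ?posrE ?mulr_gt0 // mulrC ler_pM2r //.
case/andP: delta_itv => d0 d1; have := cos_geN1 t; nra.
Qed.

Let wlow := (2 * omega)^-1.
Let wlow_gt0 : 0 < wlow. Proof. by rewrite invr_gt0 mulr_gt0. Qed.

Let shiftE (A B1 B2 : R) :
  b (B2, A) = (fun t => b (B1, A) t + (B2 - B1) * a t).
Proof. by apply/funext => t; rewrite /rsj_drift /=; ring. Qed.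

Let shift_lower (B1 B2 : R) t : B1 < B2 -> (B2 - B1) * wlow <= (B2 - B1) * a t.
Proof. by move=> lt12; rewrite ler_wpM2l // subr_ge0 ltW. Qed.

Let shift_cont (B1 B2 : R) : continuous (fun t => (B2 - B1) * a t).
Proof. by move=> t; apply: cvgMl_tmp; exact: ca. Qed.

Let shift_per (B1 B2 : R) : periodic (fun t => (B2 - B1) * a t) tau.
Proof. by move=> t; rewrite pa. Qed.

Lemma poincare_increasing (A B1 B2 x : R) : B1 < B2 -> P (B1, A) x < P (B2, A) x.
Proof.
move=> lt12; rewrite (shiftE A B1 B2).
have e0 : 0 < (B2 - B1) * wlow by rewrite mulr_gt0 // subr_gt0.
exact: (poincare_strict_mono ca (@cb (B1, A)) (@shift_cont B1 B2) pa (@pb (B1, A)) (@shift_per B1 B2)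
  e0 (fun t => shift_lower t lt12)).
Qed.

Lemma rotation_number_increasing (A B1 B2 : R) : B1 < B2 ->
  (forall (k : int) x, P (B1, A) x != x + tau * k%:~R) -> rho (B1, A) < rho (B2, A).
Proof.
move=> lt12 nofix; rewrite /rho !perturbed_RSJE (shiftE A B1 B2).
have e0 : 0 < (B2 - B1) * wlow by rewrite mulr_gt0 // subr_gt0.
exact: (rotation_number_strict ca (@cb (B1, A)) (@shift_cont B1 B2) pa (@pb (B1, A)) (@shift_per B1 B2)
  e0 (fun t => shift_lower t lt12) nofix).
Qed.

(** Two parameters give right-hand sides at distance at most a multiple of
    their distance, and [gronwall_dist] applies with equal initial values. *)
Lemma poincare_parameter_continuous x : continuous (fun p : R * R => P p x).
Proof.
have [K aK] := periodic_bounded ca pa.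
have K0 : 0 <= K := bound_ge0 aK.
pose E := expR ((2 * K + 1) * tau).
have E1 : 1 <= E by rewrite -expR0 ler_expR mulr_ge0 ?(ltW tau_gt0) // addr_ge0 // mulr_ge0.
have lip (p q : R * R) : `|P p x - P q x| <= E * (K * (`|p.1 - q.1| + `|p.2 - q.2|)).
  have sp := flow_solution ca (@cb p) pa (@pb p) x.
  have sq := flow_solution ca (@cb q) pa (@pb q) x.
  set eta := K * _.
  have eta0 : 0 <= eta by rewrite mulr_ge0 ?addr_ge0.
  have hd := hderivB (solution_hderiv sp) (solution_hderiv sq).
  have := gronwall_dist (e := eta) hd K0 (ltW tau_gt0).
  rewrite !(flow0 ca) // subrr expr0n add0r => h.
  have {}h : (P p x - P q x) ^+ 2 + eta ^+ 2 <= eta ^+ 2 * E.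
    apply: h => s _; set u := flow _ _ _ s; set v := flow _ _ _ s.
    have -> : f p u s - f q v s = (f p u s - f p v s) +
        a s * ((p.1 - q.1) + (p.2 - q.2) * sin s).
      by rewrite /phase_field /rsj_drift; ring.
    apply: le_trans (ler_normD _ _) _; apply: lerD; first exact: field_lipschitz.
    rewrite normrM /eta ler_pM // (le_trans (ler_normD _ _)) // lerD2l normrM.
    by rewrite -[leRHS]mulr1 ler_wpM2l // sin_max.
  rewrite -(@ler_pXn2r _ 2) ?nnegrE ?mulr_ge0 // ?expR_ge0 //.
  rewrite real_normK ?num_real // exprMn.
  have e2 : 0 <= eta ^+ 2 by exact: sqr_ge0.
  have : (P p x - P q x) ^+ 2 <= eta ^+ 2 * E by lra.
  move=> h'; apply: le_trans h' _; rewrite mulrC ler_wpM2r // expr2 ler_peMl //.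
  exact: le_trans E1.
move=> p; apply/cvgrPdist_lt => e e0.
have M0 : 0 < E * (K * 2) + 1.
  by rewrite ltr_wpDl // mulr_ge0 ?mulr_ge0 // expR_ge0.
pose z := e / (E * (K * 2) + 1); have z0 : 0 < z by exact: divr_gt0.
apply: filterS (nbhsx_ballx p _ z0) => q [/= h1 h2]; rewrite /ball /= in h1 h2.
apply: le_lt_trans (lip p q) _.
apply: (@le_lt_trans _ _ (E * (K * (z + z)))).
  rewrite ler_wpM2l ?expR_ge0 // ler_wpM2l // lerD // ltW //.
have -> : e = (E * (K * 2) + 1) * z by rewrite /z mulrC divfK // gt_eqF.
have -> : (E * (K * 2) + 1) * z = E * (K * (z + z)) + z by ring.
by rewrite ltrDl.
Qed.

Let a_scaled t : 1 <= a t * (2 * omega).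
Proof.
have o0 : 0 < 2 * omega by rewrite mulr_gt0.
by have := a_lower t; rewrite -ler_pdivrMr // div1r.
Qed.

Lemma poincare_large (A c : R) : exists B, forall x, x + c < P (B, A) x.
Proof.
pose y := `|c| / tau + 1 + `|D|.
have y0 : 0 < y by rewrite /y -addrA ltr_wpDl ?divr_ge0 ?(ltW tau_gt0) // ltr_wpDr.
exists (1 + `|A| + 2 * omega * y) => x.
set p := (_, _).
have s := flow_solution ca (@cb p) pa (@pb p) x.
have lin := hderivZ (`|c| / tau + 1) (@hderiv_id R).
have := hderiv_le lin (solution_hderiv s) (ltW tau_gt0).
rewrite (flow0 ca (@cb p) pa (@pb p)) -/(poincare a (b p) x) => h.
have {}h : (`|c| / tau + 1) * tau - (`|c| / tau + 1) * 0 <= P p x - x.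
  apply: h => t _; rewrite mulr1 /phase_field /rsj_drift /=.
  set th := flow _ _ _ _.
  have h1 : 2 * omega * y <= cos th + (1 + `|A| + 2 * omega * y + A * sin t).
    have : - `|A| <= A * sin t.
      have : `|A * sin t| <= `|A| by rewrite normrM -[leRHS]mulr1 ler_wpM2l // sin_max.
      by rewrite ler_norml => /andP[].
    have := cos_geN1 th; lra.
  have h2 : y <= a t * (cos th + (1 + `|A| + 2 * omega * y + A * sin t)).
    apply: (@le_trans _ _ (a t * (2 * omega * y))); last first.
      by rewrite ler_wpM2l // ltW // rsj_weight_gt0.
    by rewrite mulrA ler_peMl // ltW.
  have := ler_norm (- D); rewrite normrN => h3.
  have -> : a t * cos th + ((1 + `|A| + 2 * omega * y + A * sin t) * a t + D) =
    a t * (cos th + (1 + `|A| + 2 * omega * y + A * sin t)) + D by ring.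
  by move: h2; rewrite {1}/y; lra.
have t0 := @tau_gt0 R.
move: h; rewrite mulr0 subr0 mulrDl divfK ?gt_eqF // mul1r.
have := ler_norm c; lra.
Qed.

Lemma poincare_small (A c : R) : exists B, forall x, P (B, A) x < x + c.
Proof.
pose y := `|c| / tau + 1 + `|D|.
have y0 : 0 < y by rewrite /y -addrA ltr_wpDl ?divr_ge0 ?(ltW tau_gt0) // ltr_wpDr.
exists (- (1 + `|A| + 2 * omega * y)) => x.
set p := (_, _).
have s := flow_solution ca (@cb p) pa (@pb p) x.
have lin := hderivZ (- (`|c| / tau + 1)) (@hderiv_id R).
have := hderiv_le (solution_hderiv s) lin (ltW tau_gt0).
rewrite (flow0 ca (@cb p) pa (@pb p)) -/(poincare a (b p) x) => h.
have {}h : P p x - x <= - (`|c| / tau + 1) * tau - - (`|c| / tau + 1) * 0.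
  apply: h => t _; rewrite mulr1 /phase_field /rsj_drift /=.
  set th := flow _ _ _ _.
  have h1 : cos th + (- (1 + `|A| + 2 * omega * y) + A * sin t) <= - (2 * omega * y).
    have : A * sin t <= `|A|.
      apply: le_trans (ler_norm _) _.
      by rewrite normrM -[leRHS]mulr1 ler_wpM2l // sin_max.
    have := cos_le1 th; lra.
  have h2 : a t * (cos th + (- (1 + `|A| + 2 * omega * y) + A * sin t)) <= - y.
    apply: (@le_trans _ _ (a t * - (2 * omega * y))).
      by rewrite ler_wpM2l // ltW // rsj_weight_gt0.
    by rewrite mulrN lerN2 mulrA ler_peMl // ltW.
  have := ler_norm D => h3.
  have -> : a t * cos th + ((- (1 + `|A| + 2 * omega * y) + A * sin t) * a t + D) =
    a t * (cos th + (- (1 + `|A| + 2 * omega * y) + A * sin t)) + D by ring.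
  by move: h2; rewrite [in X in _ <= X]/y; lra.
have t0 := @tau_gt0 R.
move: h; rewrite mulr0 subr0 mulNr mulrDl divfK ?gt_eqF // mul1r.
have := ler_norm (- c); rewrite normrN; lra.
Qed.

(** The interior of the level set of the integer k, by [level_interior]. *)
Definition straddle (k : int) : set (R * R) := [set p |
  (exists x, P p x < x + tau * k%:~R) /\ (exists x, x + tau * k%:~R < P p x)].

Lemma straddle_open k : open (straddle k).
Proof.
have below : open [set p | exists x, P p x < x + tau * k%:~R].
  rewrite (_ : [set p | _] =
    \bigcup_x ((fun p => P p x) @^-1` [set y | y < x + tau * k%:~R])); last first.
    by apply/seteqP; split=> [p [x h]|p [x _ h]]; exists x.
  apply: bigcup_open => x _.
  by move: (@poincare_parameter_continuous x) => /continuousP; apply; exact: open_lt.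
have above : open [set p | exists x, x + tau * k%:~R < P p x].
  rewrite (_ : [set p | _] =
    \bigcup_x ((fun p => P p x) @^-1` [set y | x + tau * k%:~R < y])); last first.
    by apply/seteqP; split=> [p [x h]|p [x _ h]]; exists x.
  apply: bigcup_open => x _.
  by move: (@poincare_parameter_continuous x) => /continuousP; apply; exact: open_gt.
exact: openI below above.
Qed.

Lemma level_int (k : int) p : rho p = k%:~R <-> exists x, P p x = x + tau * k%:~R.
Proof. by rewrite /rho perturbed_RSJE; exact: rotation_number_int. Qed.

Lemma straddle_level k p : straddle k p -> rho p = k%:~R.
Proof.
move=> [[x h] [y h']]; apply/level_int; apply: poincare_ivt => //.
  by exists x; exact: ltW.
by exists y; exact: ltW.
Qed.

Lemma interior_horizontal (L : set (R * R)) B A : L° (B, A) ->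
  exists2 e, 0 < e & L (B - e, A) /\ L (B + e, A).
Proof.
move=> /nbhs_ballP[e /= e0 he]; exists (e / 2); first by rewrite divr_gt0.
split; apply: he; split; rewrite /ball /= ?subrr ?normr0 //.
- by rewrite opprB addrC subrK gtr0_norm ?divr_gt0 //; lra.
- by rewrite opprD addrA subrr sub0r normrN gtr0_norm ?divr_gt0 //; lra.
Qed.

Lemma level_interior k : [set p | rho p = k%:~R]° = straddle k.
Proof.
apply/seteqP; split=> [[B A] /interior_horizontal[e e0 [/level_int[x hx] /level_int[y hy]]]|].
  split; [exists y; rewrite -hy|exists x; rewrite -hx]; apply: poincare_increasing; lra.
rewrite -open_subsetE; last exact: straddle_open.
by move=> p; exact: straddle_level.
Qed.

(** At a value that is not an integer P x - x avoids 2 pi Z, and the level set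
    meets each horizontal line in at most one point. *)
Lemma phase_lock_area_int L : phase_lock_area rho L ->
  exists k : int, L = [set p | rho p = k%:~R].
Proof.
move=> [[r ->] [[B A] /interior_horizontal[e e0 [/= h1 h2]]]].
have [[k [x hx]]|nofix] := pselect (exists k : int, exists x, P (B - e, A) x = x + tau * k%:~R).
  exists k; have <- : rho (B - e, A) = k%:~R by apply/level_int; exists x.
  by rewrite h1.
have := @rotation_number_increasing A (B - e) (B + e).
rewrite h1 h2 ltxx => h; exfalso; have : false by apply: h; [lra|
  move=> k x; apply/eqP => hx; apply: nofix; exists k, x].
by [].
Qed.

Lemma poincare_near (A B x c : R) :
  (P (B, A) x < c -> exists2 e, 0 < e & forall B', `|B - B'| < e -> P (B', A) x < c) /\
  (c < P (B, A) x -> exists2 e, 0 < e & forall B', `|B - B'| < e -> c < P (B', A) x).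
Proof.
have cP := @poincare_parameter_continuous x (B, A).
have near e : 0 < e -> exists2 d, 0 < d &
    forall B', `|B - B'| < d -> `|P (B, A) x - P (B', A) x| < e.
  move=> e0; move/cvgrPdist_lt: cP => /(_ e e0) /nbhs_ballP[d /= d0 hd].
  exists d => // B' h; apply: (hd (B', A)); split => //=; exact: ballxx.
split=> h; have [|d d0 hd] := near `|c - P (B, A) x|.
- by rewrite normr_gt0 subr_eq0 gt_eqF.
- exists d => // B' /hd; rewrite [ltRHS]gtr0_norm ?subr_gt0 // ltr_norml; lra.
- by rewrite normr_gt0 subr_eq0 lt_eqF.
- exists d => // B' /hd; rewrite [ltRHS]ltr0_norm ?subr_lt0 // ltr_norml; lra.
Qed.

Lemma nontrivial_poincare (k : int) A B : A != 0 ->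
  exists x, P (B, A) x != x + tau * k%:~R.
Proof.
move=> A0; apply: contrapT => h; move/eqP: A0; apply.
apply: (@trivial_period_map_amplitude0 R omega delta D B A omega_gt0 delta_itv k) => x.
by apply/eqP; apply: contrapT => /negP hx; apply: h; exists x.
Qed.

(** At the largest B with P x <= x + 2 pi k for all x, some of these inequalities
    are strict since P is not a translation; they persist for slightly larger
    B, where another of the inequalities fails. *)
Lemma straddle_fiber (k : int) A : A != 0 -> exists B, straddle k (B, A).
Proof.
move=> A0; pose c := tau * k%:~R : R.
pose S := [set B | forall x, P (B, A) x <= x + c].
have [Bs hs] := poincare_small A c; have [Bl hl] := poincare_large A c.
have S0 : S !=set0 by exists Bs => x; exact: ltW.
have Sub : ubound S Bl.
  move=> B SB; rewrite leNgt; apply/negP => lt.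
  by have := lt_trans (hl 0) (poincare_increasing A 0 lt); rewrite ltNge SB.
have hS : has_sup S by split => //; exists Bl.
have supS : S (sup S).
  move=> x; rewrite leNgt; apply/negP => /(poincare_near A (sup S) x (x + c)).2[e e0 he].
  have [B SB hB] := sup_adherent e0 hS.
  have Ble : B <= sup S by apply: ub_le_sup => //; case: hS.
  have := he B; rewrite ger0_norm ?subr_ge0 // => /(_ _)/lt_geF.
  by rewrite SB => h; have : true = false by [apply: h; lra].
have [x0 hx0] := nontrivial_poincare k (sup S) A0.
have lt0 : P (sup S, A) x0 < x0 + c by rewrite lt_neqAle hx0 supS.
have [e e0 he] := (poincare_near A (sup S) x0 (x0 + c)).1 lt0.
exists (sup S + e / 2); split.
  exists x0; apply: he.
  by rewrite opprD addrA subrr sub0r normrN gtr0_norm ?divr_gt0 //; lra.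
apply: contrapT => h.
have : S (sup S + e / 2).
  by move=> x; rewrite leNgt; apply/negP => hx; apply: h; exists x.
move=> /(ub_le_sup (proj2 hS)); rewrite leNgt => /negP; apply.
by rewrite ltrDl divr_gt0.
Qed.

Lemma straddle_fiber_interval k A : is_interval [set B | straddle k (B, A)].
Proof.
move=> B1 B2 [_ [x hx]] [[y hy] _] B /andP[].
move=> le1 le2; split.
- exists y; move: le2; rewrite le_eqVlt => /predU1P[-> //|lt2].
  by apply: lt_trans hy; exact: poincare_increasing.
- exists x; move: le1; rewrite le_eqVlt => /predU1P[<- //|lt1].
  by apply: lt_trans hx _; exact: poincare_increasing.
Qed.

(** P is not a translation, so P x - x - 2 pi k is nonzero for some x; moving B
    slightly in the direction opposite to its sign gives another point of the
    level set on the same horizontal line. *)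
Lemma level_no_constriction (k : int) p : ~ constriction [set p | rho p = k%:~R] p.
Proof.
case: p => B A [/= /level_int[x0 h0] A0 single].
have uniq B' : straddle k (B', A) -> B' = B.
  move=> /straddle_level h.
  have : ([set p | rho p = k%:~R] `&` [set q | q.2 = A]) (B', A) by [].
  by rewrite single => -[].
have [x hx] := nontrivial_poincare k B A0.
move: hx; rewrite neq_lt => /orP[lt|gt].
- have [e e0 he] := (poincare_near A B x _).1 lt.
  have lte : B < B + e / 2 by rewrite ltrDl divr_gt0.
  have : B + e / 2 = B.
    apply: uniq; split; [exists x; apply: he|exists x0].
      by rewrite opprD addrA subrr sub0r normrN gtr0_norm ?divr_gt0 //; lra.
    by rewrite -h0; exact: poincare_increasing.
  lra.
- have [e e0 he] := (poincare_near A B x _).2 gt.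
  have lte : B - e / 2 < B by rewrite ltrBlDr ltrDl divr_gt0.
  have : B - e / 2 = B.
    apply: uniq; split; [exists x0|exists x; apply: he].
      by rewrite -h0; exact: poincare_increasing.
    by rewrite opprB addrC subrK gtr0_norm ?divr_gt0 //; lra.
  lra.
Qed.

Lemma halfplane_connected (k : int) (J : set R) : is_interval J -> open J ->
  ~ J 0 -> connected (straddle k `&` [set p | J p.2]).
Proof.
move=> iJ oJ J0; apply: (@fiberwise_connected R _ J) => //.
- apply: openI; first exact: straddle_open.
  have : continuous (fun p : R * R => p.2) by move=> p; exact: cvg_snd.
  by move/continuousP; apply.
- by move=> p [].
- move=> s Js; have s0 : s != 0 by apply/eqP => e; apply: J0; rewrite -e.
  by have [B hB] := straddle_fiber k s0; exists B.
- move=> s B1 B2 [h1 Js] [h2 _] B hB; split => //.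
  exact: straddle_fiber_interval h1 h2 B hB.
Qed.

Lemma no_constriction_pos L : phase_lock_area rho L ->
  [/\ forall p, ~ constriction L p, connected (L° `&` [set p | 0 < p.2]) &
      connected (L° `&` [set p | p.2 < 0])].
Proof.
move=> /phase_lock_area_int[k ->]; rewrite level_interior; split.
- exact: level_no_constriction.
- have iJ : is_interval [set s : R | 0 < s].
    by move=> r s /= r0 _ z /andP[rz _]; exact: lt_le_trans r0 rz.
  by have := @halfplane_connected k _ iJ (@open_gt R 0); apply; rewrite /= ltxx.
- have iJ : is_interval [set s : R | s < 0].
    by move=> r s _ /= s0 z /andP[_ zs]; exact: le_lt_trans zs s0.
  by have := @halfplane_connected k _ iJ (@open_lt R 0); apply; rewrite /= ltxx.
Qed.

(** The substitution theta -> - theta. *)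
Lemma rotation_number_reflect p :
  rotation_number (perturbed_RSJ (- omega) delta (- D) p) = - rho p.
Proof.
pose a' t := - a t; pose b' t := - b p t.
have fE : perturbed_RSJ (- omega) delta (- D) p = phase_field a' b'.
  apply/funext => th; apply/funext => t.
  rewrite /perturbed_RSJ /phase_field /a' /b' /rsj_drift /rsj_weight.
  by rewrite mulNr invrN; ring.
have ca' : continuous a' by move=> t; apply: cvgN; exact: ca.
have cb' : continuous b' by move=> t; apply: cvgN; exact: (@cb p).
have pa' : periodic a' tau by move=> t; rewrite /a' pa.
have pb' : periodic b' tau by move=> t; rewrite /b' (@pb p).
have s := flow_solution ca (@cb p) pa (@pb p) 0.
have s' : is_solution (phase_field a' b') (fun t => - flow a (b p) 0 t).
  apply: hderiv_eq (hderivN (solution_hderiv s)) _ => t.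
  by rewrite /phase_field /a' /b' cosN; ring.
rewrite fE /rho perturbed_RSJE.
have [c hc] := rotation_numberP ca (@cb p) pa (@pb p) s.
have [c' hc'] := rotation_numberP ca' cb' pa' pb' s'.
apply/eqP; rewrite -subr_eq0 opprK eq_le; apply/andP; split.
  apply: (@linear_le_bounded _ _ (c + c')) => n.
  have := hc n%:R (ler0n _ _); have := hc' n%:R (ler0n _ _); rewrite !ler_norml; lra.
rewrite -oppr_le0; apply: (@linear_le_bounded _ _ (c + c')) => n.
have := hc n%:R (ler0n _ _); have := hc' n%:R (ler0n _ _); rewrite !ler_norml; lra.
Qed.

End Family.

Theorem corollary25 (R : realType) (omega : R) (omega_neq0 : omega != 0) :
  exists delta0 eps : R,
    [/\ 0 < delta0 < 1, 0 < eps &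
      forall delta D : R, 0 < delta < delta0 -> `|D| < eps ->
      forall L : set (R * R),
        phase_lock_area
          (fun p => rotation_number (perturbed_RSJ omega delta D p)) L ->
        [/\ forall p : R * R, ~ constriction L p,
            connected (L° `&` [set p | 0 < p.2]) &
            connected (L° `&` [set p | p.2 < 0])]].
Proof.
exists (1 / 2), 1; split; [lra|exact: ltr01|].
move=> delta D /andP[d0 d1] _ L hL.
have delta_itv : 0 < delta < 1 by lra.
move: omega_neq0; rewrite neq_lt => /orP[neg|pos]; last first.
  exact: (no_constriction_pos pos delta_itv hL).
have no0 : 0 < - omega by rewrite oppr_gt0.
apply: (@no_constriction_pos R (- omega) delta (- D) no0 delta_itv).
case: hL => -[r Lr] L0; split => //; exists (- r); rewrite Lr.
apply/seteqP; split=> p /=; have := @rotation_number_reflect R (- omega) delta (- D) no0 delta_itv p;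
  rewrite !opprK => ->.
- by move=> <-; rewrite opprK.
- by move=> ->; rewrite opprK.
Qed.
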